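(* For any $w$ in the relative interior of a cone in the $\mathfrak{S}_8$-orbit of $\mathcal{C}_{\mathsf{sp}}$, the initial degeneration $\mathrm{in}_w\mathrm{Gr}_0(3,8)$ has $2$ connected components.
   Context: Everything is over $\mathbb{C}$. $\mathrm{Gr}_0(3,8)$ is the open locus of the Grassmannian $\mathrm{Gr}(3,8)\subset\mathbb{P}^{\binom{8}{3}-1}$ (of $3$-dimensional subspaces of $\mathbb{C}^8$, Plücker embedding) where all Plücker coordinates are nonzero; it is a closed subvariety of the torus $T=\mathbb{G}_m^{\binom{[8]}{3}}/\mathbb{G}_m$, with cocharacter lattice $N=\mathbb{Z}^{\binom{[8]}{3}}/\mathbb{Z}(1,\dots,1)$ and character lattice $M=\mathrm{Hom}(N,\mathbb{Z})$. Let $e_\lambda\in N$ denote the image of the standard basis vector indexed by $\lambda\in\binom{[8]}{3}$. Let $I\subset\mathbb{C}[M]$ be the prime ideal of $\mathrm{Gr}_0(3,8)$. For $w\in N_{\mathbb{R}}$ and $f=\sum_uc_ux^u$, $\mathrm{in}_wf$ is the sum of the terms $c_ux^u$ ($c_u\ne0$) with $\langle u,w\rangle$ minimal; $\mathrm{in}_wI=\langle\mathrm{in}_wf:f\in I\rangle$; $\mathrm{TGr}_0(3,8)=\{w\in N_{\mathbb{R}}:\mathrm{in}_wI\neq\langle1\rangle\}$; and for $w\in\mathrm{TGr}_0(3,8)$, $\mathrm{in}_w\mathrm{Gr}_0(3,8)\subset T$ is the closed subscheme defined by $\mathrm{in}_wI$. The symmetric group $\mathfrak{S}_8$ acts on $N_{\mathbb{R}}$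 by permuting the indices in $[8]$, preserving $\mathrm{TGr}_0(3,8)$. Let $L_{\mathbb{R}}\subset N_{\mathbb{R}}$ be the $7$-dimensional linear span of the vectors $\sum_{\lambda\ni i}e_\lambda$, $i\in[8]$. Let $\mathsf{Q}_{\mathsf{sp}}$ be the rank-$3$ matroid on $[8]$ whose bases are all elements of $\binom{[8]}{3}$ other than $126,145,178,235,248,347,368,567$ (where $ijk$ abbreviates $\{i,j,k\}$). The cone of $\mathrm{TGr}_0(3,8)$ (with its secondary fan structure) containing in its relative interior the corank vector of $\mathsf{Q}_{\mathsf{sp}}$ (whose $\lambda$-coordinate is $3-\mathrm{rank}(\lambda)$) is $$\mathcal{C}_{\mathsf{sp}}=\mathbb{R}_{\ge0}\langle e_{126},e_{145},e_{178},e_{235},e_{248},e_{347},e_{368},e_{567}\rangle+L_{\mathbb{R}}.$$ *)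

(* Defs.v *)
From HB Require Import structures.
From mathcomp Require Import all_boot all_order all_algebra all_fingroup finmap.
From mathcomp Require Import all_classical all_reals topology.
From mathcomp Require Import complex.
From mathcomp Require monalg.
(* The notations of monalg clash with those of the topology files. *)
Import -(notations) monalg.

Set Implicit Arguments.
Unset Strict Implicit.
Unset Printing Implicit Defensive.

Import Order.TTheory GRing.Theory Num.Theory.
Local Open Scope classical_set_scope.
Local Open Scope ring_scope.

(* monalg makes [malg K F] a ring only when K has no invertible element other
   than 1, which excludes groups; [grpalg G F] is the F-module [malg G F] with
   the convolution product, for G an additive group. *)
Definition grpalg (G : zmodType) (F : comNzRingType) := malg G F.

Section GroupAlgebra.
Variables (G : zmodType) (F : comNzRingType).
Implicit Types f g h : malg G F.

HB.instance Definition _ := GRing.Lmodule.on (grpalg G F).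

Definition ga_one : malg G F := mkmalgU 0 1.

Definition ga_mul f g : malg G F :=
  \sum_(u <- msupp f) \sum_(v <- msupp g)
    mkmalgU (u + v) (mcoeff u f * mcoeff v g).

Lemma ga_mulw (d1 d2 : {fset G}) f g :
  (msupp f `<=` d1)%fset -> (msupp g `<=` d2)%fset ->
  ga_mul f g = \sum_(u <- d1) \sum_(v <- d2)
    mkmalgU (u + v) (mcoeff u f * mcoeff v g).
Proof.
move=> le_d1 le_d2; rewrite /ga_mul (big_fset_incl _ le_d1) /=.
  apply/eq_bigr => u _; apply/big_fset_incl => // v _ /mcoeff_outdom ->.
  by rewrite mulr0 monalgU0.
move=> u _ /mcoeff_outdom fu.
by rewrite big1 // => v _; rewrite fu mul0r monalgU0.
Qed.

Lemma ga_mulC : commutative ga_mul.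
Proof.
move=> f g; rewrite /ga_mul exchange_big /=.
by apply/eq_bigr => v _; apply/eq_bigr => u _; rewrite addrC mulrC.
Qed.

Lemma ga_mul0g : left_zero 0 ga_mul.
Proof. by move=> g; rewrite /ga_mul msupp0 big_seq_fset0. Qed.

Lemma ga_mulUU (c d : F) (u v : G) :
  ga_mul (mkmalgU u c) (mkmalgU v d) = mkmalgU (u + v) (c * d).
Proof. by rewrite (ga_mulw msuppU_le msuppU_le) !big_seq_fset1 !mcoeffUU. Qed.

Lemma ga_mul1g : left_id ga_one ga_mul.
Proof.
move=> g; rewrite (ga_mulw msuppU_le (fsubset_refl _)) big_seq_fset1.
rewrite [RHS]monalgE; apply/eq_bigr => v _.
by rewrite mcoeffUU mul1r add0r.
Qed.

Lemma ga_mulDl : left_distributive ga_mul +%R.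
Proof.
move=> f1 f2 g; have gg := fsubset_refl (msupp g).
rewrite [in RHS](ga_mulw (fsubsetUl _ (msupp f2)) gg).
rewrite [in RHS](ga_mulw (fsubsetUr (msupp f1) _) gg) (ga_mulw (msuppD_le _ _) gg).
rewrite -big_split /=; apply/eq_bigr => u _.
rewrite -big_split /=; apply/eq_bigr => v _.
by rewrite mcoeffD mulrDl monalgUD.
Qed.

Lemma ga_mulDr : right_distributive ga_mul +%R.
Proof. by move=> f g1 g2; rewrite ga_mulC ga_mulDl !(ga_mulC f). Qed.

Lemma ga_mulEl f g :
  ga_mul f g = \sum_(u <- msupp f) ga_mul (mkmalgU u (mcoeff u f)) g.
Proof.
rewrite {1}[f]monalgE.
by rewrite (big_morph (ga_mul^~ g) (fun _ _ => ga_mulDl _ _ _) (ga_mul0g g)).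
Qed.

Lemma ga_mulEr f g :
  ga_mul f g = \sum_(v <- msupp g) ga_mul f (mkmalgU v (mcoeff v g)).
Proof. by rewrite ga_mulC ga_mulEl; apply/eq_bigr => v _; rewrite ga_mulC. Qed.

Lemma ga_mulA : associative ga_mul.
Proof.
have gm0 f : ga_mul f 0 = 0 by rewrite ga_mulC ga_mul0g.
have suml (I : Type) (r : seq I) (E : I -> malg G F) g :
    ga_mul (\sum_(i <- r) E i) g = \sum_(i <- r) ga_mul (E i) g.
  exact: (big_morph (ga_mul^~ g) (fun _ _ => ga_mulDl _ _ _) (ga_mul0g g)).
have sumr (I : Type) (r : seq I) (E : I -> malg G F) g :
    ga_mul g (\sum_(i <- r) E i) = \sum_(i <- r) ga_mul g (E i).
  exact: (big_morph (ga_mul g) (fun _ _ => ga_mulDr _ _ _) (gm0 g)).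
move=> f g h; rewrite [f]monalgE !suml; apply/eq_bigr => u _.
rewrite [g]monalgE !(suml, sumr); apply/eq_bigr => v _.
rewrite [h]monalgE !sumr; apply/eq_bigr => t _.
by rewrite !ga_mulUU addrA mulrA.
Qed.

Lemma ga_one_neq0 : ga_one != 0.
Proof.
apply/eqP => /malgP /(_ 0) /eqP.
by rewrite mcoeffUU mcoeff0 oner_eq0.
Qed.

HB.instance Definition _ := GRing.Zmodule_isComNzRing.Build (grpalg G F)
  ga_mulA ga_mulC ga_mul1g ga_mulDl ga_one_neq0.
End GroupAlgebra.

(* The prime spectrum of a commutative ring, with the Zariski topology. Since
   [idealr_closed] excludes 1, its points are the proper prime ideals. *)
Record Spec (A : comNzRingType) := PrimeIdeal {
  prime_set :> A -> bool;
  prime_ideal : idealr_closed prime_set;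
  prime_mul : prime_idealr_closed prime_set }.

Section Zariski.
Variable A : comNzRingType.

HB.instance Definition _ := gen_eqMixin (Spec A).
HB.instance Definition _ := gen_choiceMixin (Spec A).

Definition zeros (E : set A) : set (Spec A) :=
  [set P : Spec A | forall f, E f -> P f].

Definition zariski_open (U : set (Spec A)) : Prop :=
  exists E : set A, U = ~` zeros E.

Lemma zariski_openT : zariski_open setT.
Proof.
exists setT; apply/seteqP; split => // -[P [_ P1 _] ?] _ /(_ 1 I) /=.
exact/negP.
Qed.

Lemma zariski_openI : setI_closed zariski_open.
Proof.
move=> _ _ [E ->] [F ->]; exists [set e.1 * e.2 | e in E `*` F].
rewrite -setCU; congr (~` _); apply/seteqP; split => P /=.
  have idM a f : P f -> P (a * f).
    case: P => P [P0 _ PD] ? /= Pf.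
    by have := PD a f 0 Pf P0; rewrite addr0.
  case=> PE _ [[e f] [/= Ee Ff] <-]; last exact/idM/PE.
  by rewrite mulrC; exact/idM/PE.
move=> PEF; have [|nPE] := pselect (zeros E P); first by left.
right=> f Ff; move/existsNP: nPE => [e /not_implyP[Ee nPe]].
have /PEF : [set e.1 * e.2 | e in E `*` F] (e * f) by exists (e, f).
by move/(@prime_mul _ P)/orP => [|].
Qed.

Lemma zariski_open_bigcup (I : Type) (U : I -> set (Spec A)) :
  (forall i, zariski_open (U i)) -> zariski_open (\bigcup_i U i).
Proof.
move=> /choice[E UE]; exists (\bigcup_i E i).
rewrite -[LHS]setCK setC_bigcup; congr (~` _); apply/seteqP; split => P /=.
  move=> PE f [i _ Ef]; have := PE i Logic.I; rewrite UE /= => /contrapT; exact.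
by move=> PE i _; rewrite UE /= => nPE; apply: nPE => f Ef; apply: PE; exists i.
Qed.

HB.instance Definition _ := isOpenTopological.Build (Spec A)
  zariski_openT zariski_openI zariski_open_bigcup.

(* The ideal generated by S. *)
Definition ideal_gen (S : set A) : set A :=
  [set f | exists n (a g : 'I_n -> A),
     (forall i, S (g i)) /\ f = \sum_(i < n) a i * g i].
End Zariski.

(* The set of connected components of a subspace. *)
Definition components (T : topologicalType) (X : set T) : set (set T) :=
  [set connected_component X x | x in X].

Section RelativeInterior.
Variables (R : realType) (J : finType).
Implicit Types (C : set (J -> R)).

Definition affine_hull C : set (J -> R) :=
  [set y | exists n (t : 'I_n -> R) (x : 'I_n -> J -> R),
     [/\ forall i, C (x i), \sum_(i < n) t i = 1
       & forall j, y j = \sum_(i < n) t i * x i j]].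

(* The Euclidean topology of R^J is given by its sup-norm balls. *)
Definition relint C : set (J -> R) :=
  [set x | C x /\ exists2 eps : R, 0 < eps &
     forall y, affine_hull C y -> (forall j, `|y j - x j| < eps) -> C y].
End RelativeInterior.

(* 3-element subsets of [8]; the label i of [8] = {1, ..., 8} is the ordinal
   i - 1. *)
Definition triple := {l : {set 'I_8} | #|l| == 3%N}.
HB.instance Definition _ := Finite.on triple.

Definition lab (i : nat) : 'I_8 := inord i.-1.
Definition tri (i j k : nat) : {set 'I_8} := [set lab i; lab j; lab k]%SET.

Lemma card_perm_triple (s : 'S_8) (l : triple) : #|s @: val l| == 3%N.
Proof. by rewrite card_imset; [exact: (svalP l) | exact: perm_inj]. Qed.

Definition perm_triple (s : 'S_8) (l : triple) : triple :=
  exist _ (s @: val l) (card_perm_triple s l).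

(* The character lattice M = Hom(Z^J / Z(1, ..., 1), Z), J the set of
   triples: the vectors of Z^J with coordinate sum 0. *)
Definition sum0 : {pred {ffun triple -> int}} :=
  [pred u : {ffun triple -> int} | \sum_l u l == 0].

Lemma sum0_zmod_closed : zmod_closed sum0.
Proof.
split=> [|u v]; rewrite !inE; first by rewrite big1 // => l _; rewrite ffunE.
move=> /eqP u0 /eqP v0; under eq_bigr do rewrite !ffunE.
by rewrite sumrB u0 v0 subrr.
Qed.

HB.instance Definition _ := GRing.isZmodClosed.Build _ sum0 sum0_zmod_closed.

Record charlat := Charlat {
  expo :> {ffun triple -> int};
  expo_sum0 : expo \in sum0 }.
HB.instance Definition _ := [isSub for expo].
HB.instance Definition _ := [Choice of charlat by <:].
HB.instance Definition _ := [SubChoice_isSubZmodule of charlat by <:].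

Section Grassmannian.
Variable F : fieldType.

(* The Plücker coordinate of the row space of A: the columns are taken in
   increasing order, as [enum] lists the elements of l increasingly. *)
Definition plucker (A : 'M[F]_(3, 8)) (l : triple) : F :=
  \det (colsub (fun j : 'I_3 => nth ord0 (enum (val l)) j) A).

(* The F-points of Gr_0(3,8), a closed subset of the torus T = G_m^J / G_m,
   each given by all its vectors of homogeneous coordinates. *)
Definition Gr0 : set (triple -> F) :=
  [set x | (forall l, x l != 0) /\
     exists2 A : 'M[F]_(3, 8), row_free A & x = plucker A].

(* The value of f in F[M] at the point of T with homogeneous coordinates x;
   [^] is the power with integer exponent. *)
Definition laurent_eval (f : grpalg charlat F) (x : triple -> F) : F :=
  \sum_(u <- msupp f) mcoeff u f * \prod_l x l ^ (u l).

Definition IGr0 : set (grpalg charlat F) :=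
  [set f | forall x, Gr0 x -> laurent_eval f x = 0].

Variable R : realType.

(* A vector of N_R = R^J / R(1, ..., 1) is given by a representative in R^J,
   and a subset of N_R by its preimage in R^J. *)
Definition pairing (u : charlat) (w : triple -> R) : R :=
  \sum_l (u l)%:~R * w l.

Lemma pairing_shift (u : charlat) (w : triple -> R) (c : R) :
  pairing u (fun l => w l + c) = pairing u w.
Proof.
rewrite /pairing; under eq_bigr do rewrite mulrDr.
rewrite big_split /= -mulr_suml -raddf_sum /=.
by have := expo_sum0 u; rewrite inE => /eqP ->; rewrite mul0r addr0.
Qed.

Definition initial_form (w : triple -> R) (f : grpalg charlat F) :
    grpalg charlat F :=
  \sum_(u <- msupp f | all (fun v => pairing u w <= pairing v w) (msupp f))
    mkmalgU u (mcoeff u f).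

Definition initial_ideal (w : triple -> R) (I : set (grpalg charlat F)) :
    set (grpalg charlat F) :=
  ideal_gen [set initial_form w f | f in I].

(* The underlying space of the closed subscheme of T = Spec F[M] defined by
   the initial ideal, as a subspace of Spec F[M]. *)
Definition initial_degeneration (w : triple -> R) :
    set (Spec (grpalg charlat F)) :=
  zeros (initial_ideal w IGr0).
End Grassmannian.
Arguments initial_degeneration F {R} w.

Section SpecialCone.
Variable R : realType.

Definition e_ (m : triple) : triple -> R := fun l => (l == m)%:R.

Definition nonbases_sp : {set {set 'I_8}} :=
  [set tri 1 2 6; tri 1 4 5; tri 1 7 8; tri 2 3 5;
       tri 2 4 8; tri 3 4 7; tri 3 6 8; tri 5 6 7]%SET.

(* The preimage in R^J of the linear span L of the vectors
   sum_(m containing i) e_m of N_R; hence the constant c. *)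
Definition lineality : set (triple -> R) :=
  [set w | exists (b : 'I_8 -> R) (c : R), forall l,
     w l = \sum_i b i * (\sum_(m : triple | i \in val m) e_ m l) + c].

Definition Csp : set (triple -> R) :=
  [set w | exists a : triple -> R, exists2 v, lineality v &
     (forall m, 0 <= a m) /\
     forall l, w l = \sum_(m : triple | val m \in nonbases_sp) a m * e_ m l
                     + v l].

(* The action on R^J sending e_l to e_(s l). *)
Definition perm_weight (s : 'S_8) (w : triple -> R) : triple -> R :=
  fun l => w (perm_triple s^-1 l).

Definition Csp_orbit : set (set (triple -> R)) :=
  [set [set perm_weight s w | w in Csp] | s in [set: 'S_8]].
End SpecialCone.

(* Main.v *)
(* The nonbases of Q_sp are the lines of the Moebius-Kantor configuration 8_3, which
   has exactly two projective realizations over C, one for each root of z^2 - z + 1.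
   For such a root alpha, let X_alpha be the set of points of the torus T whose
   coordinates at the bases are the Pluecker coordinates of a realization, up to
   rescaling of its columns, and whose coordinates at the eight nonbases are arbitrary.
   It is a translate of a subtorus, so the functions vanishing on it form a prime
   P_alpha.  The initial degeneration consists of the primes above one of the two
   P_alpha:
   - every prime P containing in_w I yields a point of T over the field of fractions of
     the quotient by P. The initial forms of the three-term Pluecker relations say that
     this point, with the coordinates at the nonbases replaced by 0, still satisfies the
     three-term relations; solving these shows that the point lies on X_alpha for one
     alpha, whence P contains P_alpha;
   - conversely the eight minors of the nonbases are local coordinates near a
     realization, so every point of X_alpha is a limit of w-rescaled points of Gr_0;
     taking limits in f = 0 gives in_w f = 0 on X_alpha for f in I.
   The two sets of primes are irreducible, and they are disjoint because a cross-ratio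
   is constant on X_alpha, with a value depending on alpha. *)

From HB Require Import structures.
Require Import Defs.
From mathcomp Require Import all_boot all_order all_algebra all_fingroup finmap.
From mathcomp Require Import all_classical all_reals topology normedtype sequences exp.
From mathcomp Require Import complex ring lra zify.
From mathcomp Require monalg.
Import -(notations) monalg.
Set Implicit Arguments.
Unset Strict Implicit.
Unset Printing Implicit Defensive.
Import Order.TTheory GRing.Theory Num.Theory numFieldNormedType.Exports.
Local Open Scope classical_set_scope.
Local Open Scope ring_scope.

(** * Prime ideals as kernels of morphisms to fields *)

Section DomainFractions.
Variable Q : comNzRingType.
Hypothesis Q_domain : GRing.integral_domain_axiom Q.

(** An alias that carries the integral domain structure required by [{fraction _}], while [Q] keeps
    its own. Units and inverses are chosen classically. *)
Definition dom : Type := Q.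
HB.instance Definition _ := GRing.ComNzRing.on dom.

Let unitQ : pred dom := fun x => `[< exists y, y * x = 1 >].
Let invQ (x : dom) : dom := if pselect (exists y, y * x = 1) is left xV
  then projT1 (cid xV) else x.

Let mulVQ : {in unitQ, left_inverse 1 invQ *%R}.
Proof.
move=> x /asboolP xV; rewrite /invQ; case: pselect => // {}xV.
by case: cid.
Qed.
Let unitPQ x y : y * x = 1 -> unitQ x.
Proof. by move=> yx; apply/asboolP; exists y. Qed.
Let invQ_out : {in [predC unitQ], invQ =1 id}.
Proof.
by move=> x /asboolP nx; rewrite /invQ; case: pselect.
Qed.
HB.instance Definition _ :=
  GRing.ComNzRing_hasMulInverse.Build dom mulVQ unitPQ invQ_out.
Let dom_domain : GRing.integral_domain_axiom dom. Proof. exact: Q_domain. Qed.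
HB.instance Definition _ := GRing.ComUnitRing_isIntegral.Build dom dom_domain.

Lemma domain_embeds_in_field :
  exists (K : fieldType) (phi : {rmorphism Q -> K}), injective phi.
Proof.
pose phi : {rmorphism dom -> {fraction dom}} := @tofrac dom.
exists {fraction dom}, phi.
by move=> x y /eqP; rewrite tofrac_eq => /eqP.
Qed.
End DomainFractions.

Section PrimeResidue.
Variables (A : comNzRingType) (P : Spec A).

HB.instance Definition _ := isIdealr.Build A (prime_set P) (prime_ideal P).
HB.instance Definition _ := isPrimeIdealrClosed.Build A (prime_set P) (@prime_mul A P).

Local Open Scope quotient_scope.

(** The quotient of [A] by [P] is a domain, and [K] is its field of fractions. *)
Lemma prime_is_kernel :
  exists (K : fieldType) (rho : {rmorphism A -> K}), forall a, P a = (rho a == 0).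
Proof.
pose I : prime_idealr A := prime_set P.
pose p (a : A) : {ideal_quot I} := \pi_({ideal_quot I}) a.
have pB : zmod_morphism p by move=> x y; rewrite /p !piE.
have pM : monoid_morphism p by split=> [|x y]; rewrite /p !piE.
pose pH := GRing.isZmodMorphism.Build _ _ p pB.
pose pH2 := GRing.isMonoidMorphism.Build _ _ p pM.
pose pR : {rmorphism A -> {ideal_quot I}} := HB.pack p pH pH2.
have [K [phi phiI]] := domain_embeds_in_field (@Quotient.rquot_IdomainAxiom A I).
exists K, (phi \o pR) => a /=.
rewrite -[0 in RHS](rmorph0 phi) (inj_eq phiI) -(rmorph0 pR).
by rewrite /= /p -Quotient.idealrBE subr0.
Qed.
End PrimeResidue.

(** * Laurent polynomials evaluated at points of the torus *)

Section MonomialValues.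
Variable k : fieldType.
Implicit Types (x y : triple -> k) (u v : charlat).

Definition monom x u : k := \prod_l x l ^ u l.

Lemma charlatD u v l : (u + v) l = u l + v l.
Proof. by rewrite -[LHS]/(val (u + v) l) raddfD ffunE. Qed.

Lemma charlat0 l : (0 : charlat) l = 0.
Proof. by rewrite -[LHS]/(val (0 : charlat) l) raddf0 ffunE. Qed.

Lemma charlat_sum0 u : \sum_l u l = 0.
Proof. by have := expo_sum0 u; rewrite inE => /eqP. Qed.

Lemma monomD x u v : (forall l, x l != 0) ->
  monom x (u + v) = monom x u * monom x v.
Proof.
move=> x0; rewrite -big_split; apply: eq_bigr => l _.
by rewrite charlatD expfzDr.
Qed.

Lemma monom0 x : monom x 0 = 1.
Proof. by apply: big1 => l _; rewrite charlat0 expr0z. Qed.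

Lemma monomM x y u : monom (fun l => x l * y l) u = monom x u * monom y u.
Proof. by rewrite -big_split; apply: eq_bigr => l _; rewrite expfzMl. Qed.

Lemma prod_expz (I : Type) (r : seq I) (a : k) (n : I -> int) : a != 0 ->
  \prod_(i <- r) a ^ n i = a ^ (\sum_(i <- r) n i).
Proof.
move=> a0; elim/big_rec2: _ => [|i m p _ ->]; first by rewrite expr0z.
by rewrite expfzDr.
Qed.

(** The exponents of a character sum to 0; this makes its value independent of the choice of
    homogeneous coordinates. *)
Lemma monom_const (a : k) u : a != 0 -> monom (fun=> a) u = 1.
Proof. by move=> a0; rewrite /monom prod_expz // charlat_sum0 expr0z. Qed.

Lemma monom_scale (a : k) x u : a != 0 -> monom (fun l => a * x l) u = monom x u.
Proof. by move=> a0; rewrite monomM monom_const // mul1r. Qed.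
End MonomialValues.

Lemma rmorph_monom (F k : fieldType) (iota : {rmorphism F -> k}) x (u : charlat) :
  iota (monom x u) = monom (iota \o x) u.
Proof. by rewrite rmorph_prod; apply: eq_bigr => l _; rewrite /= fmorphXz. Qed.

Section Evaluation.
Variables (F k : fieldType) (iota : {rmorphism F -> k}).
Implicit Types (x : triple -> k) (f g : grpalg charlat F).

(** Points over an extension of [F] are needed because the residue field of a prime can be larger
    than [F]. *)
Definition ev x f : k := \sum_(u <- msupp f) iota (mcoeff u f) * monom x u.

Lemma ev_supp x f (d : {fset charlat}) : (msupp f `<=` d)%fset ->
  ev x f = \sum_(u <- d) iota (mcoeff u f) * monom x u.
Proof.
move=> fd; apply: big_fset_incl => // u _ /mcoeff_outdom ->.
by rewrite rmorph0 mul0r.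
Qed.

Lemma ev_additive x : zmod_morphism (ev x).
Proof.
move=> f g; pose d := (msupp f `|` msupp g)%fset.
rewrite (@ev_supp x (f - g) d) ?msuppB_le //.
rewrite (@ev_supp x f d) ?fsubsetUl // (@ev_supp x g d) ?fsubsetUr //.
by rewrite -sumrB; apply: eq_bigr => u _; rewrite mcoeffB rmorphB mulrBl.
Qed.

HB.instance Definition _ x :=
  GRing.isZmodMorphism.Build (grpalg charlat F) k (ev x) (@ev_additive x).

Lemma ev_monomial x u (c : F) : ev x (mkmalgU u c) = iota c * monom x u.
Proof. by rewrite (ev_supp _ msuppU_le) big_seq_fset1 mcoeffUU. Qed.

Lemma evM x f g : (forall l, x l != 0) -> ev x (f * g) = ev x f * ev x g.
Proof.
move=> x0; rewrite -[f * g]/(ga_mul f g) /ga_mul raddf_sum mulr_suml.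
apply: eq_bigr => u _; rewrite raddf_sum mulr_sumr; apply: eq_bigr => v _.
by rewrite /= ev_monomial rmorphM monomD // mulrACA.
Qed.

Lemma ev1 x : ev x 1 = 1.
Proof. by rewrite -[1]/(ga_one _ _) ev_monomial rmorph1 monom0 mulr1. Qed.
End Evaluation.

Lemma laurent_evalE (F : fieldType) (f : grpalg charlat F) x :
  laurent_eval f x = ev idfun x f.
Proof. by []. Qed.

Section PointOfMorphism.
Variables (F k : fieldType) (rho : {rmorphism grpalg charlat F -> k}).

Definition mono (u : charlat) (c : F) : grpalg charlat F := mkmalgU u c.

Lemma monoM u v c d : mono u c * mono v d = mono (u + v) (c * d).
Proof. exact: ga_mulUU. Qed.

Lemma const_zmod_morphism : zmod_morphism (rho \o mono 0).
Proof. by move=> c d /=; rewrite /mono monalgUB rmorphB. Qed.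

Lemma const_monoid_morphism : monoid_morphism (rho \o mono 0).
Proof.
split=> [|c d] /=; first by rewrite -[mono 0 1]/(1 : grpalg charlat F) rmorph1.
by rewrite -rmorphM monoM addr0.
Qed.

Definition const_morph : F -> k := rho \o mono 0.
HB.instance Definition _ := GRing.isZmodMorphism.Build F k const_morph const_zmod_morphism.
HB.instance Definition _ := GRing.isMonoidMorphism.Build F k const_morph const_monoid_morphism.

Variable l0 : triple.

(** The exponents of the coordinate ratio $x_l/x_{l_0}$. *)
Definition dirac_diff (l : triple) : {ffun triple -> int} :=
  [ffun m => (m == l)%:Z - (m == l0)%:Z].

Lemma dirac_diff_sum0 l : dirac_diff l \in sum0.
Proof.
have h (l' : triple) : \sum_m (m == l')%:Z = 1.
  by rewrite (bigD1 l') //= eqxx big1 ?addr0 // => m /negPf ->.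
rewrite inE; apply/eqP; under eq_bigr do rewrite ffunE.
by rewrite big_split /= (h l) sumrN (h l0).
Qed.

Definition ratio (l : triple) : charlat := Charlat (dirac_diff_sum0 l).

(** Homogeneous coordinates normalized to be 1 at [l0]. *)
Definition point_of (l : triple) : k := rho (mono (ratio l) 1).

(** The multiples of the basis vector at [l0] add up to minus the coordinate sum of [u], which is
    0. *)
Lemma charlat_expand (u : charlat) : u = \sum_l ratio l *~ u l.
Proof.
have sE (r : seq triple) (E : triple -> charlat) m :
    (\sum_(l <- r) E l) m = \sum_(l <- r) (E l) m.
  elim/big_rec2: _ => [|l a b _ <-]; first by rewrite charlat0.
  by rewrite charlatD.
have mE (v : charlat) (n : nat) m : (v *+ n) m = v m *+ n.
  elim: n => [|n IH]; first by rewrite !mulr0n charlat0.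
  by rewrite !mulrS charlatD IH.
have oE (v : charlat) m : (- v) m = - v m.
  by rewrite -[LHS]/(val (- v) m) raddfN ffunE.
have zE (v : charlat) (n : int) m : (v *~ n) m = n * v m.
  case: n => n; first by rewrite -pmulrn mE -mulr_natl natz.
  by rewrite NegzE mulrNz oE -pmulrn mE -mulr_natl mulNr natz.
apply: val_inj; apply/ffunP => m /=; rewrite sE.
under eq_bigr do rewrite zE ffunE mulrBr.
have zc (c : int) : \sum_l u l * c = 0 by rewrite -[LHS]mulr_suml charlat_sum0 mul0r.
have -> : u m = \sum_l u l * (m == l)%:Z.
  rewrite (bigD1 m) //= eqxx mulr1 big1 ?addr0 // => l lm.
  by rewrite eq_sym (negPf lm) mulr0.
by rewrite big_split /= -[LHS]addr0; congr (_ + _); rewrite sumrN zc.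
Qed.

Lemma character_unit u : rho (mono u 1) != 0.
Proof.
apply/eqP => u0; have := oner_neq0 k; rewrite -(rmorph1 rho).
have -> : 1 = mono u 1 * mono (- u) 1 by rewrite monoM subrr mulr1.
by rewrite rmorphM u0 mul0r eqxx.
Qed.

Lemma point_of_neq0 l : point_of l != 0.
Proof. exact: character_unit. Qed.

Lemma character_monom u : rho (mono u 1) = monom point_of u.
Proof.
have D a b : rho (mono (a + b) 1) = rho (mono a 1) * rho (mono b 1).
  by rewrite -rmorphM monoM mulr1.
have z0 : rho (mono 0 1) = 1.
  by rewrite -[mono 0 1]/(1 : grpalg charlat F) rmorph1.
have n a n : rho (mono (a *+ n) 1) = rho (mono a 1) ^+ n.
  by elim: n => [|n IH]; rewrite ?mulr0n ?z0 // mulrS D IH exprS.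
have nV a : rho (mono (- a) 1) = (rho (mono a 1))^-1.
  by apply: (mulIf (character_unit a)); rewrite -D addNr z0 mulVf ?character_unit.
rewrite {1}[u]charlat_expand.
rewrite (big_morph (fun a => rho (mono a 1)) D z0); apply: eq_bigr => l _.
case: (u l) => m; first by rewrite -pmulrn n.
by rewrite NegzE mulrNz -pmulrn nV n -exprnN.
Qed.

(** Additivity reduces this to monomials, and [charlat_expand] reduces those to coordinate ratios.
    Hence every morphism from the group algebra to a field is evaluation at a point of the torus. *)
Lemma ev_point_of f : ev const_morph point_of f = rho f.
Proof.
rewrite {2}[f]monalgE raddf_sum; apply: eq_bigr => u _.
rewrite -character_monom /= /const_morph /= -rmorphM; congr (rho _).
by rewrite monoM add0r mulr1.
Qed.
End PointOfMorphism.

(** * Torus cosets and their vanishing ideals *)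

Section LaurentPolynomials.
Variables (F : numDomainType) (k : fieldType).

(** The positive integers have infinitely many images in [k], too many to be all roots of [p]. Zero
    is left out for the sake of Laurent polynomials. *)
Lemma poly_nonroot (iota : {rmorphism F -> k}) (p : {poly k}) :
    injective iota -> p != 0 -> exists n : nat, p.[iota n.+1%:R] != 0.
Proof.
move=> iota_inj p0; apply/not_existsP => pz.
pose rs := [seq iota n.+1%:R | n <- seq.iota 0 (size p)].
have rs_uniq : uniq rs.
  rewrite map_inj_uniq ?iota_uniq // => m n /iota_inj /eqP.
  by rewrite eqr_nat => /eqP [].
have rs_roots : all (root p) rs.
  by apply/allP => _ /mapP [n _ ->]; apply/negPn/negP => /pz.
by have := max_poly_roots p0 rs_roots rs_uniq; rewrite size_map size_iota ltnn.
Qed.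

(** Multiplication by $z^N$, with [N] the sum of the absolute values of the exponents, gives a
    polynomial; it vanishes at the images of all positive integers, so it is zero. *)
Lemma laurent_vanish (iota : {rmorphism F -> k}) (I : eqType) (r : seq I)
    (a : I -> k) (n : I -> int) : injective iota ->
  (forall c : F, c != 0 -> \sum_(i <- r) a i * iota c ^ n i = 0) ->
  forall z, z != 0 -> \sum_(i <- r) a i * z ^ n i = 0.
Proof.
move=> iota_inj v z z0.
pose N := (\sum_(i <- r) `|n i|)%N.
have nN i : i \in r -> 0 <= N%:Z + n i.
  move=> ir; suff : `|n i| <= N%:Z by rewrite ler_norml -subr_ge0 opprK addrC => /andP[].
  by rewrite /N (big_rem i ir) /= PoszD abszE lerDl.
pose p := \sum_(i <- r) a i *: 'X^`|N%:Z + n i|.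
have pE y : y != 0 -> p.[y] = y ^+ N * \sum_(i <- r) a i * y ^ n i.
  move=> y0; rewrite horner_sum mulr_sumr; apply: eq_big_seq => i ir.
  rewrite hornerZ hornerXn mulrCA; congr (_ * _).
  by rewrite !exprnP -expfzDr // gez0_abs ?nN.
have [p0|/(poly_nonroot iota_inj) [m]] := eqVneq p 0.
  have /esym/eqP := pE z z0; rewrite p0 horner0 mulf_eq0 expf_eq0 (negPf z0) andbF.
  by move/eqP.
rewrite pE ?v ?mulr0 ?eqxx ?pnatr_eq0 // -(rmorph0 iota) (inj_eq iota_inj).
by rewrite pnatr_eq0.
Qed.
End LaurentPolynomials.

Section RationalFunctions.
Variables (F : fieldType) (q : {poly F}).

(** The functions regular on the open subset $q \neq 0$ of the affine line; the values of [phi] at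
    the zeros of [q] are unconstrained. *)
Definition ratfun (phi : F -> F) := exists (p : {poly F}) (N : nat),
  forall z, q.[z] != 0 -> phi z * q.[z] ^+ N = p.[z].

Lemma ratfun_poly p : ratfun (horner p).
Proof. by exists p, 0 => z _; rewrite mulr1. Qed.

Lemma ratfun_cst c : ratfun (fun=> c).
Proof. by exists c%:P, 0 => z _; rewrite mulr1 hornerC. Qed.

Lemma ratfunD f g : ratfun f -> ratfun g -> ratfun (fun z => f z + g z).
Proof.
move=> [p [M fp]] [p' [N gp']]; exists (p * q ^+ N + p' * q ^+ M), (M + N)%N.
move=> z z0; rewrite hornerD !hornerM !horner_exp -fp // -gp' // exprD; ring.
Qed.

Lemma ratfunM f g : ratfun f -> ratfun g -> ratfun (fun z => f z * g z).
Proof.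
move=> [p [M fp]] [p' [N gp']]; exists (p * p'), (M + N)%N.
move=> z z0; rewrite hornerM -fp // -gp' // exprD; ring.
Qed.

Lemma ratfun_sum (I : Type) (r : seq I) (f : I -> F -> F) :
  (forall i, ratfun (f i)) -> ratfun (fun z => \sum_(i <- r) f i z).
Proof.
move=> fr; elim: r => [|i r IH].
  by have [p [N h]] := ratfun_cst 0; exists p, N => z; rewrite big_nil; apply: h.
have [p [N h]] := ratfunD (fr i) IH.
by exists p, N => z; rewrite big_cons; apply: h.
Qed.

Lemma ratfun_prod (I : Type) (r : seq I) (f : I -> F -> F) :
  (forall i, ratfun (f i)) -> ratfun (fun z => \prod_(i <- r) f i z).
Proof.
move=> fr; elim: r => [|i r IH].
  by have [p [N h]] := ratfun_cst 1; exists p, N => z; rewrite big_nil; apply: h.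
have [p [N h]] := ratfunM (fr i) IH.
by exists p, N => z; rewrite big_cons; apply: h.
Qed.

Lemma ratfunX f n : ratfun f -> ratfun (fun z => f z ^+ n).
Proof.
move=> fr; elim: n => [|n IH]; first exact: ratfun_cst.
have [p [N h]] := ratfunM fr IH.
by exists p, N => z; rewrite exprS; apply: h.
Qed.

Lemma ratfunXz p n : p %| q -> ratfun (fun z => p.[z] ^ n).
Proof.
move=> /dvdpP [p' qE]; case: n => n; first exact/ratfunX/ratfun_poly.
have pV : ratfun (fun z => p.[z]^-1).
  exists p', 1%N => z; rewrite expr1 qE hornerM mulf_eq0 negb_or => /andP [_ pz].
  by rewrite mulrCA mulVf ?mulr1.
have [p1 [N h]] := ratfunX n.+1 pV; exists p1, N => z z0.
by rewrite NegzE -exprnN -exprVn h.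
Qed.
End RationalFunctions.

Section TorusCoset.
Variables (C : numFieldType) (J : finType) (H : triple -> J -> int).
Variables (chi : triple -> C) (chi_neq0 : forall l, chi l != 0).

(** A parametrized coset: the translate by [chi] of the image of a torus under the monomial map with
    exponents [H]. *)
Definition tpoint (k : fieldType) (iota : C -> k) (t : J -> k) (l : triple) : k :=
  iota (chi l) * \prod_j t j ^ H l j.

Definition texpo (u : charlat) (j : J) : int := \sum_l H l j * u l.

Section OverField.
Variables (k : fieldType) (iota : {rmorphism C -> k}).

Lemma tpoint_neq0 t : (forall j, t j != 0) -> forall l, tpoint iota t l != 0.
Proof.
move=> t0 l; rewrite mulf_neq0 ?fmorph_eq0 //.
by apply/prodf_neq0 => j _; rewrite expfz_neq0.
Qed.

Lemma monom_tpoint t u : (forall j, t j != 0) ->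
  monom (tpoint iota t) u = iota (monom chi u) * \prod_j t j ^ texpo u j.
Proof.
move=> t0; rewrite monomM rmorph_monom; congr (_ * _).
rewrite /monom /texpo; under [RHS]eq_bigr do rewrite -prod_expz //.
rewrite exchange_big; apply: eq_bigr => l _.
have h1 : (1 : k) ^ u l = 1 by rewrite exp1rz.
rewrite (big_morph (fun x : k => x ^ u l) (fun x y => expfzMl x y _) h1).
by apply: eq_bigr => j _; rewrite exprz_exp.
Qed.
End OverField.

Definition coset_ideal (f : grpalg charlat C) : bool :=
  `[< forall t, (forall j, t j != 0) -> ev idfun (tpoint idfun t) f = 0 >].

(** The parameters leave [C] one at a time: with the others fixed, the value of [f] is a Laurent
    polynomial in one of them, and it is zero as soon as it vanishes at all nonzero elements of
    [C]. *)
Lemma coset_idealP (k : fieldType) (iota : {rmorphism C -> k}) f :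
  coset_ideal f -> forall t, (forall j, t j != 0) -> ev iota (tpoint iota t) f = 0.
Proof.
move=> /asboolP f0.
(* [s] lists the parameters that may lie outside the image of [C]. *)
suff main (s : seq J) (t : J -> k) : (forall j, t j != 0) ->
    (forall j, j \notin s -> exists c, t j = iota c) -> ev iota (tpoint iota t) f = 0.
  move=> t t0; apply: (main (index_enum J)) => // j.
  by rewrite mem_index_enum.
elim: s t => [|j s IH] t t0 tC.
  have /choice [c tE] : forall j, exists c, t j = iota c by move=> j; apply: tC.
  have c0 j : c j != 0 by have := t0 j; rewrite tE fmorph_eq0.
  have := congr1 iota (f0 c c0); rewrite rmorph0 => <-.
  rewrite /ev rmorph_sum; apply: eq_bigr => u _; rewrite rmorphM /= rmorph_monom.
  congr (_ * _); apply: eq_bigr => l _; congr (_ ^ _).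
  rewrite /tpoint /= rmorphM rmorph_prod; congr (_ * _).
  by apply: eq_bigr => j _; rewrite tE fmorphXz.
pose tz z i := if i == j then z else t i.
have tz0 z : z != 0 -> forall i, tz z i != 0.
  by move=> z0 i; rewrite /tz; case: (i =P j).
pose a u := iota (mcoeff u f) *
  (iota (monom chi u) * \prod_(i | i != j) t i ^ texpo u i).
have evE z : z != 0 -> ev iota (tpoint iota (tz z)) f =
    \sum_(u <- msupp f) a u * z ^ texpo u j.
  move=> z0; apply: eq_bigr => u _; rewrite monom_tpoint; last exact: tz0.
  rewrite (bigD1 j) //= {1}/tz eqxx /a -!mulrA; congr (_ * (_ * _)).
  rewrite mulrC; congr (_ * _); apply: eq_bigr => i ij.
  by rewrite /tz (negPf ij).
have -> : t = tz (t j) by apply/funext => i; rewrite /tz; case: (i =P j) => [->|].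
rewrite evE //; apply: (laurent_vanish (fmorph_inj iota)) => // c c0.
have ic0 : iota c != 0 by rewrite fmorph_eq0.
rewrite -evE //; apply: IH => [|i is_]; first exact: tz0.
rewrite /tz; case: (i =P j) => [_|/eqP ij]; first by exists c.
by apply: tC; rewrite inE negb_or ij.
Qed.

Lemma coset_ideal_idealr : idealr_closed coset_ideal.
Proof.
split.
- by apply/asboolP => t _; rewrite raddf0.
- apply/asboolP => h; have /eqP := h (fun=> 1) (fun=> oner_neq0 _).
  by rewrite ev1 oner_eq0.
move=> f g h /asboolP g0 /asboolP h0; apply/asboolP => t t0.
by rewrite raddfD /= evM ?g0 ?h0 ?mulr0 ?addr0 //; apply: (tpoint_neq0 idfun).
Qed.

(* Two points of the torus lie on a line, and along it [ev] is a rational function. *)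
Lemma coset_ideal_prime : prime_idealr_closed coset_ideal.
Proof.
move=> f g /asboolP fg; apply/negPn/negP; rewrite negb_or => /andP [].
move=> /asboolP/existsNP [s /not_implyP [s0 /eqP fs]].
move=> /asboolP/existsNP [t /not_implyP [t0 /eqP gt]].
pose L j : {poly C} := (s j)%:P + (t j - s j) *: 'X.
have L0 : (fun j => (L j).[0]) = s.
  by apply/funext => j; rewrite !hornerE.
have L1 : (fun j => (L j).[1]) = t.
  apply/funext => j; rewrite /L hornerD hornerZ hornerX hornerC.
  by rewrite mulr1 subrKC.
pose q := \prod_j L j.
have Lq j : L j %| q by rewrite /q (bigD1 j) //= dvdp_mulIl.
have Lz z : q.[z] != 0 -> forall j, (L j).[z] != 0.
  by move=> qz j; apply: contraNneq qz; have /dvdpP [p ->] := Lq j;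
    rewrite hornerM => ->; rewrite mulr0.
have reg e : exists p N, forall z, q.[z] != 0 ->
    ev idfun (tpoint idfun (fun j => (L j).[z])) e * q.[z] ^+ N = p.[z].
  apply: (@ratfun_sum _ q charlat (msupp e)
    (fun u z => _ * monom (tpoint idfun (fun j => (L j).[z])) u)) => u.
  have [p [N h]] : ratfun q (fun z => mcoeff u e * (monom chi u *
      \prod_j (L j).[z] ^ texpo u j)).
    apply/ratfunM/ratfunM/ratfun_prod => [||j]; [exact: ratfun_cst..|exact: ratfunXz].
  exists p, N => z z0; rewrite monom_tpoint ?h //; exact: Lz.
have [pf [Nf hf]] := reg f; have [pg [Ng hg]] := reg g.
have q0 : q.[0] != 0.
  by rewrite horner_prod; apply/prodf_neq0 => j _; rewrite (congr1 (@^~ j) L0).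
have q1 : q.[1] != 0.
  by rewrite horner_prod; apply/prodf_neq0 => j _; rewrite (congr1 (@^~ j) L1).
have pf0 : pf != 0.
  apply: contra_eq_neq (hf 0 q0) => ->; rewrite L0 horner0.
  by rewrite mulf_neq0 ?expf_neq0.
have pg0 : pg != 0.
  apply: contra_eq_neq (hg 1 q1) => ->; rewrite L1 horner0.
  by rewrite mulf_neq0 ?expf_neq0.
have qn0 : q != 0 by apply: contraNneq q0 => ->; rewrite horner0.
(* At a point of the line where [q] and both numerators are nonzero, neither [f] nor [g]
   vanishes. *)
have [n] := @poly_nonroot C C idfun _ (fun _ _ => id)
  (mulf_neq0 (mulf_neq0 pf0 pg0) qn0).
move: n.+1%:R => z /=; rewrite !hornerM !mulf_eq0 !negb_or => /andP [/andP [pfz pgz] qz].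
have := fg _ (Lz z qz); rewrite evM; last by apply: (tpoint_neq0 idfun); apply: Lz.
move/eqP; rewrite mulf_eq0 => /orP [] /eqP e0.
  by move: pfz; rewrite -hf // e0 mul0r eqxx.
by move: pgz; rewrite -hg // e0 mul0r eqxx.
Qed.

Definition coset_spec : Spec (grpalg charlat C) :=
  PrimeIdeal coset_ideal_idealr coset_ideal_prime.
End TorusCoset.

(** * Pluecker coordinates as alternating brackets *)

Section Determinants.
Variable F : comNzRingType.

Definition det3 (I : Type) (c : I -> nat -> F) (i j k : I) : F :=
  c i 0%N * (c j 1%N * c k 2%N - c k 1%N * c j 2%N) -
  c j 0%N * (c i 1%N * c k 2%N - c k 1%N * c i 2%N) +
  c k 0%N * (c i 1%N * c j 2%N - c j 1%N * c i 2%N).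

Lemma det_mx33 (M : 'M[F]_3) :
  \det M = det3 (fun j i : nat => M (inord i) (inord j)) 0%N 1%N 2%N.
Proof.
rewrite (expand_det_row _ ord0) !big_ord_recl big_ord0 /cofactor.
rewrite !(expand_det_row _ ord0) !big_ord_recl !big_ord0 /cofactor !det_mx11 !mxE.
pose m i j := M (inord i) (inord j).
have mE i j : M i j = m i j by rewrite /m !inord_val.
rewrite !mE /det3 -!/(m _ _) /bump /=; ring.
Qed.

Definition column (A : 'M[F]_(3, 8)) (j : 'I_8) (i : nat) : F := A (inord i) j.

Lemma det3_swap12 (I : Type) (c : I -> nat -> F) i j k :
  det3 c j i k = - det3 c i j k.
Proof. by rewrite /det3; ring. Qed.

Lemma det3_swap23 (I : Type) (c : I -> nat -> F) i j k :
  det3 c i k j = - det3 c i j k.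
Proof. by rewrite /det3; ring. Qed.
End Determinants.

Definition default_triple : triple.
Proof.
refine (exist _ [set inord 0%N; inord 1%N; inord 2%N]%SET _).
by rewrite finset.setUC cardsU1 cards2 !inE -!val_eqE /= !inordK.
Defined.

(** Made total by a default value, taken when two of the labels coincide. *)
Definition tr3 (i j k : 'I_8) : triple := insubd default_triple [set i; j; k]%SET.

Lemma val_tr3 i j k : uniq [:: i; j; k] -> val (tr3 i j k) = [set i; j; k]%SET.
Proof.
rewrite /= !inE => /and3P [/norP [ij ik] jk _].
rewrite val_insubd ifT // finset.setUC cardsU1 cards2 !inE.
by rewrite !(eq_sym k) (negPf ik) (negPf jk) ij.
Qed.

Lemma tr3C12 i j k : tr3 j i k = tr3 i j k.
Proof. by rewrite /tr3 (finset.setUC [set j]%SET). Qed.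

Lemma tr3C23 i j k : tr3 i k j = tr3 i j k.
Proof. by rewrite /tr3 finset.setUAC. Qed.

Lemma enum_ltn_sorted n (A : {set 'I_n}) : sorted ltn (map val (enum A)).
Proof.
rewrite -[enum _](eq_filter (mem_enum _)) -(eq_filter (mem_map val_inj _)).
by rewrite -filter_map (sorted_filter ltn_trans) // -enumT val_enum_ord iota_ltn_sorted.
Qed.

Lemma enum_sorted3 (i j k : 'I_8) : (i < j)%N -> (j < k)%N ->
  enum [set i; j; k]%SET = [:: i; j; k].
Proof.
move=> ij jk; apply: (inj_map val_inj).
apply: (irr_sorted_eq ltn_trans ltnn); first exact: enum_ltn_sorted.
  by rewrite /= ij jk.
by apply: eq_mem_map => m; rewrite mem_enum !inE orbA.
Qed.

Lemma triple_sorted (l : triple) :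
  exists i j k : 'I_8, [/\ (i < j)%N, (j < k)%N & l = tr3 i j k].
Proof.
have := enum_ltn_sorted (val l); have := svalP l; rewrite cardE.
case E : (enum _) => [|i [|j [|k []]]] //= _ /and3P [ij jk _].
exists i, j, k; split => //; apply: val_inj; rewrite val_tr3.
  by apply/finset.setP => m; rewrite -mem_enum E !inE orbA.
rewrite /= !inE negb_or -!val_eqE /= !neq_ltn ij jk.
by rewrite (ltn_trans ij jk).
Qed.

(* The sign of the permutation sorting i, j, k. *)
Definition sign3 (i j k : 'I_8) : bool := (j < i)%N (+) (k < j)%N (+) (k < i)%N.

(** The alternating extension of the coordinates to ordered triples of distinct labels, so that the
    Pluecker relations need no ordering of the labels. *)
Definition bracket (F : pzRingType) (x : triple -> F) (i j k : 'I_8) : F :=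
  (-1) ^+ sign3 i j k * x (tr3 i j k).

Lemma uniq3 (T : eqType) (a b c : T) :
  uniq [:: a; b; c] = [&& a != b, a != c & b != c].
Proof. by rewrite /= !inE negb_or andbT -andbA. Qed.

Section Bracket.
Variable F : comNzRingType.
Implicit Types (x : triple -> F) (i j k : 'I_8).

Lemma bracket_swap12 x i j k : uniq [:: i; j; k] ->
  bracket x j i k = - bracket x i j k.
Proof.
rewrite /bracket tr3C12 -mulNr /= !inE negb_or => /and3P [/andP [ij _] _ _].
congr (_ * _); rewrite /sign3; move: ij; rewrite -val_eqE /=.
by case: (ltngtP i j) => //= _ _; do 2!case: (_ < _)%N;
  rewrite //= ?expr0 ?expr1 ?opprK.
Qed.

Lemma bracket_swap23 x i j k : uniq [:: i; j; k] ->
  bracket x i k j = - bracket x i j k.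
Proof.
rewrite /bracket tr3C23 -mulNr /= !inE => /and3P [_ jk _].
congr (_ * _); rewrite /sign3; move: jk; rewrite -val_eqE /=.
by case: (ltngtP j k) => //= _ _; do 2!case: (_ < _)%N;
  rewrite //= ?expr0 ?expr1 ?opprK.
Qed.
End Bracket.

Section PluckerBracket.
Variable F : fieldType.
Implicit Types (A : 'M[F]_(3, 8)) (i j k : 'I_8).

Lemma plucker_sorted A i j k : (i < j)%N -> (j < k)%N ->
  plucker A (tr3 i j k) = det3 (column A) i j k.
Proof.
move=> ij jk; rewrite /plucker val_tr3; last first.
  rewrite /= !inE negb_or -!val_eqE /= !neq_ltn ij jk.
  by rewrite (ltn_trans ij jk).
by rewrite enum_sorted3 // det_mx33 /det3 /column !mxE !inordK.
Qed.

(** Both sides change sign under transpositions, which reduces the claim to increasing labels. *)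
Lemma bracket_plucker A i j k : uniq [:: i; j; k] ->
  bracket (plucker A) i j k = det3 (column A) i j k.
Proof.
have base i' j' k' : (i' < j')%N -> (j' < k')%N ->
    bracket (plucker A) i' j' k' = det3 (column A) i' j' k'.
  move=> ij jk; rewrite /bracket plucker_sorted // /sign3.
  by rewrite !leq_gtF ?(ltnW ij) ?(ltnW jk) ?(ltnW (ltn_trans ij jk)) // mul1r.
move=> u; have s12 a b c : uniq [:: a; b; c] ->
    bracket (plucker A) a b c = det3 (column A) a b c ->
    bracket (plucker A) b a c = det3 (column A) b a c.
  by move=> uabc h; rewrite (bracket_swap12 _ uabc) h -det3_swap12.
have s23 a b c : uniq [:: a; b; c] ->
    bracket (plucker A) a b c = det3 (column A) a b c ->
    bracket (plucker A) a c b = det3 (column A) a c b.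
  by move=> uabc h; rewrite (bracket_swap23 _ uabc) h -det3_swap23.
have u12 a b c : uniq [:: a; b; c] -> uniq [:: b; a; c].
  by rewrite !uniq3 (eq_sym b a) => /and3P [-> -> ->].
have u23 a b c : uniq [:: a; b; c] -> uniq [:: a; c; b].
  by rewrite !uniq3 (eq_sym c b) => /and3P [-> -> ->].
case: (ltngtP i j) (u) => [ij|ji|/val_inj ->]; last by rewrite uniq3 eqxx.
  case: (ltngtP j k) => [jk _|kj uu|/val_inj ->]; last by rewrite uniq3 eqxx !andbF.
    exact: base.
  case: (ltngtP i k) (uu) => [ik|ki|/val_inj e] _; last by rewrite uniq3 e eqxx andbF in uu.
  - by apply: s23; [exact: u23 | exact: base].
  - by apply/s23/s12/base; [exact: u23|exact/u12/u23|..].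
case: (ltngtP i k) => [ik _|ki uu|/val_inj ->]; last by rewrite uniq3 eqxx andbF.
  by apply/s12/base; [exact: u12|..].
case: (ltngtP j k) (uu) => [jk|kj|/val_inj e] _; last by rewrite uniq3 e eqxx !andbF in uu.
- by apply/s12/s23/base; [exact: u12|exact/u23/u12|..].
- by apply/s12/s23/s12/base; [exact: u12|exact/u23/u12|exact/u12/u23/u12|..].
Qed.
End PluckerBracket.

Lemma perm_tr3 (s : 'S_8) i j k : uniq [:: i; j; k] ->
  perm_triple s (tr3 i j k) = tr3 (s i) (s j) (s k).
Proof.
move=> u; apply: val_inj; rewrite val_tr3.
  by rewrite /= val_tr3 // !imsetU !imset_set1.
by move: u; rewrite !uniq3 !(inj_eq perm_inj).
Qed.

(** * The Moebius-Kantor configuration and its realizations *)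

Definition nonbasis (p q r : nat) : bool :=
  (p, q, r) \in [:: (1, 2, 6); (1, 4, 5); (1, 7, 8); (2, 3, 5);
                    (2, 4, 8); (3, 4, 7); (3, 6, 8); (5, 6, 7)]%N.

Definition triples8 : seq (nat * nat * nat) :=
  [seq x <- [seq (x, r) | x <- [seq (p, q) | p <- seq.iota 1 8, q <- seq.iota 1 8],
             r <- seq.iota 1 8] | sorted ltn [:: x.1.1; x.1.2; x.2]].

(** This turns a claim about increasing labels into 56 explicit cases. *)
Lemma mem_triples8 p q r : sorted ltn [:: 0; p; q; r; 9]%N -> (p, q, r) \in triples8.
Proof.
move=> s; have /= := s; rewrite andbT => /and4P [p0 pq qr r9].
have q9 := ltn_trans qr r9; have p9 := ltn_trans pq q9.
have : all (fun x => all (fun y => all (fun z => sorted ltn [:: 0; x; y; z; 9]%N ==>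
  ((x, y, z) \in triples8)) (seq.iota 0 9)) (seq.iota 0 9)) (seq.iota 0 9) by vm_compute.
move=> /allP/(_ p); rewrite mem_iota => /(_ p9)/allP/(_ q).
rewrite mem_iota => /(_ q9)/allP/(_ r); rewrite mem_iota => /(_ r9).
by move/implyP/(_ s).
Qed.

(* Homogeneous coordinates of the Moebius-Kantor configuration [8_3], whose eight
   lines are the nonbases; [a] is a primitive sixth root of unity. *)
Definition mk_col (R : pzRingType) (a : R) (p i : nat) : R :=
  nth 0 (nth [::] [:: [::]; [:: 1; 0; 0]; [:: 0; 1; 0]; [:: 0; 0; 1]; [:: 1; 1; 1];
    [:: 0; 1; 1]; [:: 1; a; 0]; [:: 1; 1; 1 - a]; [:: 1; a; 1]] p) i.

Section MoebiusKantor.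
Variable k : comNzRingType.
Implicit Types a u v l : k.

(** This lemma and the next two prove equalities modulo a relation $l = 0$: what remains is an
    identity for [ring]. *)
Lemma sub_eq_of_eq0 u v l : l = 0 -> u - v = l -> u = v.
Proof. by move=> -> /eqP; rewrite subr_eq0 => /eqP. Qed.

Lemma sub_eq_of_eq0N u v l : l = 0 -> u - v = - l -> u = v.
Proof. by move=> -> /eqP; rewrite oppr0 subr_eq0 => /eqP. Qed.

Lemma sub_eq_of_eq0M u v l c : l = 0 -> u - v = c * l -> u = v.
Proof. by move=> -> /eqP; rewrite mulr0 subr_eq0 => /eqP. Qed.

Ltac unit_with ea e := exists e => _; first [ring | apply: (sub_eq_of_eq0N ea); ring].

(** Since $a(1-a)=1$, the elements $\pm 1$, $\pm a$, $\pm(1-a)$ are units, and modulo the equation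
    of [a] every minor at a basis is one of them. *)
Lemma mk_det_unit a p q r : a ^+ 2 - a + 1 = 0 ->
  sorted ltn [:: 0; p; q; r; 9]%N -> ~~ nonbasis p q r ->
  exists e, det3 (mk_col a) p q r * e = 1.
Proof.
move=> ea /mem_triples8 pqr nb.
suff [e e1] : exists e, ~~ nonbasis p q r -> det3 (mk_col a) p q r * e = 1.
  by exists e; apply: e1.
move: pqr {nb}; rewrite /triples8 /= !inE.
repeat case/orP; move=> /eqP [-> -> ->]; rewrite /det3 /mk_col /=;
  (* The witness 0 is for the nonbases, where the premise is false. *)
  first [ by exists 0 | by unit_with ea (1 : k) | by unit_with ea (-1 : k)
        | by unit_with ea a | by unit_with ea (- a) | by unit_with ea (1 - a)
        | by unit_with ea (a - 1) ].
Qed.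

Section Realization.
Variable g : nat -> nat -> nat -> k.

(* The three-term Pluecker relations among five increasing labels; in the i-th one the
   i-th label is the repeated one. *)
Let inc p q r s t := sorted ltn [:: 0; p; q; r; s; t; 9]%N.
Hypothesis R1 : forall p q r s t, inc p q r s t ->
  g p q r * g p s t - g p q s * g p r t + g p q t * g p r s = 0.
Hypothesis R2 : forall p q r s t, inc p q r s t ->
  g p q r * g q s t - g p q s * g q r t + g p q t * g q r s = 0.
Hypothesis R3 : forall p q r s t, inc p q r s t ->
  g p q r * g r s t - g p r s * g q r t + g p r t * g q r s = 0.
Hypothesis R4 : forall p q r s t, inc p q r s t ->
  g p q s * g r s t - g p r s * g q s t + g p s t * g q r s = 0.
Hypothesis g_nonbasis : forall p q r, nonbasis p q r -> g p q r = 0.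
(** These are the minors of the standard projective frame in columns 1 to 4; [g_scale] then fixes
    the scalings of columns 5 to 8. *)
Hypothesis g_frame : [/\ g 1 2 3 = 1, g 1 2 4 = 1, g 1 3 4 = -1 & g 2 3 4 = 1].
Hypothesis g_scale : [/\ g 1 2 5 = 1, g 2 3 6 = 1, g 2 3 7 = 1 & g 2 3 8 = 1].

Ltac solve_from h es :=
  first [ by apply: (sub_eq_of_eq0 h); rewrite ?es; ring
        | by apply: (sub_eq_of_eq0N h); rewrite ?es; ring ].

(* Solving the relations one unknown at a time, every coefficient of an unknown being
   invertible, leaves one parameter [a] and one equation. *)
Lemma frame_realization : exists2 a, a ^+ 2 - a + 1 = 0 &
  forall p q r, sorted ltn [:: 0; p; q; r; 9]%N -> g p q r = det3 (mk_col a) p q r.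
Proof.
case: g_frame => e123 e124 e134 e234; case: g_scale => e125 e236 e237 e238.
have [e126 e145 e178 e235] :
  [/\ g 1 2 6 = 0, g 1 4 5 = 0, g 1 7 8 = 0 & g 2 3 5 = 0] by split; apply: g_nonbasis.
have [e248 e347 e368 e567] :
  [/\ g 2 4 8 = 0, g 3 4 7 = 0, g 3 6 8 = 0 & g 5 6 7 = 0] by split; apply: g_nonbasis.
(* The minor of columns 1, 3, 6 of [mk_col a] is [- a]. *)
pose a := - g 1 3 6; have e136 : g 1 3 6 = - a by rewrite opprK.
clearbody a.
have e135 : g 1 3 5 = - 1
  by solve_from (@R1 1%N 2%N 3%N 4%N 5%N isT) (e123, e145, e124, e125, e134).
have e245 : g 2 4 5 = - 1
  by solve_from (@R2 1%N 2%N 3%N 4%N 5%N isT) (e123, e124, e235, e125, e234).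
have e345 : g 3 4 5 = 1
  by solve_from (@R3 1%N 2%N 3%N 4%N 5%N isT) (e123, e134, e235, e135, e234).
have e146 : g 1 4 6 = - a
  by solve_from (@R1 1%N 2%N 3%N 4%N 6%N isT) (e123, e124, e136, e126, e134).
have e246 : g 2 4 6 = 1
  by solve_from (@R2 1%N 2%N 3%N 4%N 6%N isT) (e123, e124, e236, e126, e234).
have e346 : g 3 4 6 = - 1 + a
  by solve_from (@R3 1%N 2%N 3%N 4%N 6%N isT) (e123, e134, e236, e136, e234).
have e137 : g 1 3 7 = - 1
  by solve_from (@R3 1%N 2%N 3%N 4%N 7%N isT) (e123, e347, e134, e237, e234).
have e128 : g 1 2 8 = 1
  by solve_from (@R2 1%N 2%N 3%N 4%N 8%N isT) (e123, e248, e124, e238, e234).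
have e156 : g 1 5 6 = - a
  by solve_from (@R1 1%N 2%N 3%N 5%N 6%N isT) (e123, e125, e136, e126, e135).
have e256 : g 2 5 6 = 1
  by solve_from (@R2 1%N 2%N 3%N 5%N 6%N isT) (e123, e125, e236, e126, e235).
have e356 : g 3 5 6 = - 1
  by solve_from (@R3 1%N 2%N 3%N 5%N 6%N isT) (e123, e135, e236, e136, e235).
have e257 : g 2 5 7 = 1
  by solve_from (@R2 1%N 2%N 3%N 5%N 7%N isT) (e123, e125, e237, e235).
have e357 : g 3 5 7 = - 1
  by solve_from (@R3 1%N 2%N 3%N 5%N 7%N isT) (e123, e135, e237, e137, e235).
have e258 : g 2 5 8 = 1
  by solve_from (@R2 1%N 2%N 3%N 5%N 8%N isT) (e123, e125, e238, e128, e235).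
have e358 : g 3 5 8 = - 1
  by solve_from (@R3 1%N 2%N 3%N 5%N 8%N isT) (e123, e135, e238, e235).
have e367 : g 3 6 7 = 1 - a
  by solve_from (@R3 1%N 2%N 3%N 6%N 7%N isT) (e123, e136, e237, e137, e236).
have e168 : g 1 6 8 = a
  by solve_from (@R1 1%N 2%N 3%N 6%N 8%N isT) (e123, e126, e128, e136).
have e268 : g 2 6 8 = - 1
  by solve_from (@R2 1%N 2%N 3%N 6%N 8%N isT) (e123, e126, e238, e128, e236).
have e138 : g 1 3 8 = - a
  by solve_from (@R3 1%N 2%N 3%N 6%N 8%N isT) (e123, e368, e136, e238, e236).
have e378 : g 3 7 8 = - 1 + a
  by solve_from (@R3 1%N 2%N 3%N 7%N 8%N isT) (e123, e137, e238, e138, e237).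
have e456 : g 4 5 6 = - a
  by solve_from (@R3 1%N 2%N 4%N 5%N 6%N isT) (e124, e145, e246, e146, e245).
have e157 : g 1 5 7 = - a
  by solve_from (@R3 1%N 2%N 5%N 6%N 7%N isT) (e125, e567, e156, e257, e256).
have e147 : g 1 4 7 = - a
  by solve_from (@R1 1%N 3%N 4%N 5%N 7%N isT) (e134, e157, e135, e137, e145).
have e457 : g 4 5 7 = - a
  by solve_from (@R3 1%N 3%N 4%N 5%N 7%N isT) (e134, e145, e347, e147, e345).
have e348 : g 3 4 8 = - 1 + a
  by solve_from (@R2 1%N 3%N 4%N 5%N 8%N isT) (e134, e358, e135, e138, e345).
have e167 : g 1 6 7 = a - a ^+ 2
  by solve_from (@R1 1%N 3%N 4%N 6%N 7%N isT) (e134, e136, e147, e137, e146).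
have e467 : g 4 6 7 = a - a ^+ 2
  by solve_from (@R3 1%N 3%N 4%N 6%N 7%N isT) (e134, e146, e347, e147, e346).
have e148 : g 1 4 8 = - a ^+ 2
  by solve_from (@R1 1%N 3%N 4%N 7%N 8%N isT) (e134, e178, e137, e138, e147).
have e478 : g 4 7 8 = - a + a ^+ 2
  by solve_from (@R3 1%N 3%N 4%N 7%N 8%N isT) (e134, e147, e348, e148, e347).
have e158 : g 1 5 8 = - a ^+ 2
  by solve_from (@R1 1%N 3%N 5%N 7%N 8%N isT) (e135, e178, e137, e138, e157).
have e578 : g 5 7 8 = - a + a ^+ 2
  by solve_from (@R3 1%N 3%N 5%N 7%N 8%N isT) (e135, e157, e358, e158, e357).
have e678 : g 6 7 8 = a - 2 * a ^+ 2 + a ^+ 3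
  by solve_from (@R4 1%N 3%N 6%N 7%N 8%N isT) (e137, e167, e378, e178, e367).
have e247 : g 2 4 7 = a
  by solve_from (@R3 2%N 3%N 4%N 5%N 7%N isT) (e234, e457, e245, e347, e345).
have e458 : g 4 5 8 = 1 - a
  by solve_from (@R3 2%N 3%N 4%N 5%N 8%N isT) (e234, e245, e348, e248, e345).
have e267 : g 2 6 7 = - 1 + a
  by solve_from (@R1 2%N 3%N 4%N 6%N 7%N isT) (e234, e236, e247, e237, e246).
have e468 : g 4 6 8 = - 1 + a
  by solve_from (@R3 2%N 3%N 4%N 6%N 8%N isT) (e234, e246, e348, e248, e346).
have e278 : g 2 7 8 = - a
  by solve_from (@R1 2%N 3%N 4%N 7%N 8%N isT) (e234, e237, e248, e238, e247).
have e568 : g 5 6 8 = - 1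
  by solve_from (@R4 2%N 3%N 5%N 6%N 8%N isT) (e236, e256, e368, e268, e356).
(* All values in this relation are known by now, so it becomes the equation of [a]. *)
have ea : a ^+ 2 - a + 1 = 0
  by solve_from (@R4 2%N 3%N 5%N 7%N 8%N isT) (e237, e578, e257, e378, e278, e357).
have e127 : g 1 2 7 = 1 - a
  by solve_from (@R1 1%N 2%N 3%N 4%N 7%N isT) (e123, e147, e124, e137, e134).
exists a => // p q r /mem_triples8; rewrite /triples8 /= !inE.
repeat case/orP; move=> /eqP [-> -> ->]; rewrite /det3 /mk_col /=;
  rewrite ?(e123, e124, e125, e126, e127, e128, e134, e135, e136, e137, e138, e145,
    e146, e147, e148, e156, e157, e158, e167, e168, e178, e234, e235, e236, e237,
    e238, e245, e246, e247, e248, e256, e257, e258, e267, e268, e278, e345, e346,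
    e347, e348, e356, e357, e358, e367, e368, e378, e456, e457, e458, e467, e468,
    e478, e567, e568, e578, e678);
  first [ring | by apply: (sub_eq_of_eq0 ea); ring | by apply: (sub_eq_of_eq0N ea); ring
        | by apply: (sub_eq_of_eq0M (c := a - 1) ea); ring ].
Qed.
End Realization.
End MoebiusKantor.

Section Rescaling.
Variables (k : fieldType) (g : nat -> nat -> nat -> k).

Let inc p q r s t := sorted ltn [:: 0; p; q; r; s; t; 9]%N.
Hypothesis R1 : forall p q r s t, inc p q r s t ->
  g p q r * g p s t - g p q s * g p r t + g p q t * g p r s = 0.
Hypothesis R2 : forall p q r s t, inc p q r s t ->
  g p q r * g q s t - g p q s * g q r t + g p q t * g q r s = 0.
Hypothesis R3 : forall p q r s t, inc p q r s t ->
  g p q r * g r s t - g p r s * g q r t + g p r t * g q r s = 0.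
Hypothesis R4 : forall p q r s t, inc p q r s t ->
  g p q s * g r s t - g p r s * g q s t + g p s t * g q r s = 0.
Hypothesis g_nonbasis : forall p q r, nonbasis p q r -> g p q r = 0.
Hypothesis g_basis : forall p q r, sorted ltn [:: 0; p; q; r; 9]%N ->
  ~~ nonbasis p q r -> g p q r != 0.

Ltac nonzero := repeat first [done | apply: expf_neq0 | apply: mulf_neq0].

(** The coordinates of a projective frame are nonzero, so rescaling the columns and the whole vector
    reaches the normalization of [frame_realization]. *)
Lemma mk_realization : exists (a c : k) (t : nat -> k),
  [/\ a ^+ 2 - a + 1 = 0, c != 0, forall n, t n != 0 &
      forall p q r, sorted ltn [:: 0; p; q; r; 9]%N ->
        g p q r = c * (t p * t q * t r) * det3 (mk_col a) p q r].
Proof.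
have n0 p q r : sorted ltn [:: 0; p; q; r; 9]%N && ~~ nonbasis p q r -> g p q r != 0.
  by move=> /andP [? ?]; apply: g_basis.
have n123 := n0 1%N 2%N 3%N isT; have n124 := n0 1%N 2%N 4%N isT.
have n134 := n0 1%N 3%N 4%N isT; have n234 := n0 2%N 3%N 4%N isT.
(* With column 4 unscaled, these and [c] solve the four equations of [g_frame]. *)
pose t1 := g 1 2 3 / g 2 3 4; pose t2 := - g 1 2 3 / g 1 3 4; pose t3 := g 1 2 3 / g 1 2 4.
have t10 : t1 != 0 by rewrite mulf_neq0 ?invr_eq0.
have t20 : t2 != 0 by rewrite mulf_neq0 ?invr_eq0 ?oppr_eq0.
have t30 : t3 != 0 by rewrite mulf_neq0 ?invr_eq0.
pose c := g 1 2 3 / (t1 * t2 * t3).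
have c0 : c != 0 := mulf_neq0 n123 (invr_neq0 (mulf_neq0 (mulf_neq0 t10 t20) t30)).
(* The last four entries solve [g_scale]; the default 1 keeps [t] nonzero at every index. *)
pose t n := nth 1 [:: 1; t1; t2; t3; 1; g 1 2 5 / (c * t1 * t2);
  g 2 3 6 / (c * t2 * t3); g 2 3 7 / (c * t2 * t3); g 2 3 8 / (c * t2 * t3)] n.
have t_neq0 n : t n != 0.
  rewrite /t; do 9?[case: n => [|n] /=]; rewrite ?oner_eq0 ?nth_nil ?oner_eq0 //;
    repeat first [done | exact: n0 | apply: mulf_neq0 | rewrite invr_eq0].
pose h p q r := (c * (t p * t q * t r))^-1 * g p q r.
have hE p q r : g p q r = c * (t p * t q * t r) * h p q r.
  by rewrite /h mulVKf //; nonzero.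
have scale (e f : k) : e != 0 -> f = 0 -> forall l, f = e * l -> l = 0.
  by move=> e0 -> l /esym/eqP; rewrite mulf_eq0 (negPf e0) => /eqP.
have [a ea ha] : exists2 a, a ^+ 2 - a + 1 = 0 &
    forall p q r, sorted ltn [:: 0; p; q; r; 9]%N -> h p q r = det3 (mk_col a) p q r.
  apply: frame_realization.
  (* The three terms of a relation rescale by the same factor, in which the repeated label counts
     twice. *)
  - move=> p q r s u i; apply: (scale (c ^+ 2 * t p ^+ 2 * t q * t r * t s * t u) _ _ (R1 i)).
      by nonzero.
    by rewrite !hE; ring.
  - move=> p q r s u i; apply: (scale (c ^+ 2 * t p * t q ^+ 2 * t r * t s * t u) _ _ (R2 i)).
      by nonzero.
    by rewrite !hE; ring.
  - move=> p q r s u i; apply: (scale (c ^+ 2 * t p * t q * t r ^+ 2 * t s * t u) _ _ (R3 i)).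
      by nonzero.
    by rewrite !hE; ring.
  - move=> p q r s u i; apply: (scale (c ^+ 2 * t p * t q * t r * t s ^+ 2 * t u) _ _ (R4 i)).
      by nonzero.
    by rewrite !hE; ring.
  - by move=> p q r nb; rewrite /h g_nonbasis ?mulr0.
  - have eqn (x y z : k) : x != 0 -> y = z * x -> x^-1 * y = z by move=> x0 ->; field.
    split; apply: eqn; nonzero; rewrite /t /= /c /t1 /t2 /t3; field;
      rewrite ?oppr_eq0 ?n123 ?n124 ?n134 ?n234 //.
  - have eq1 (x y : k) : x != 0 -> y = x -> x^-1 * y = 1 by move=> x0 ->; rewrite mulVf.
    have solve (b x y z : k) : b != 0 -> x != 0 -> y != 0 ->
        z = b * (x * y * (z / (b * x * y))) by move=> b0 x0 y0; field; rewrite b0 x0 y0.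
    split; apply: eq1; nonzero; exact: solve.
exists a, c, t; split => // p q r i; by rewrite hE ha.
Qed.
End Rescaling.

(** * Relabelling of the eight points by a permutation *)

Lemma sorted_labelsE p q r : sorted ltn [:: 0; p; q; r; 9]%N ->
  [/\ (0 < p)%N, (p < q)%N, (q < r)%N & (r < 9)%N].
Proof. by rewrite /= andbT => /and4P. Qed.

Lemma mem_nonbases_sp p q r : sorted ltn [:: 0; p; q; r; 9]%N ->
  (tri p q r \in nonbases_sp) = nonbasis p q r.
Proof.
(* The membership mask replaces equality of sets by a comparison that [vm_compute] decides. *)
pose mask (x y z : nat) := [seq [|| n == x, n == y | n == z] | n <- seq.iota 1 8].
have tri_mask x y z : sorted ltn [:: 0; x; y; z; 9]%N ->
    [seq lab n \in tri x y z | n <- seq.iota 1 8] = mask x y z.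
  move=> /sorted_labelsE [x0 xy yz z9]; apply/seq.eq_in_map => n.
  rewrite mem_iota => /andP [n0 n9]; rewrite !inE -orbA.
  have labE m m' : (0 < m < 9)%N -> (0 < m' < 9)%N -> (lab m == lab m') = (m == m').
    move=> /andP [m0 m9] /andP [m'0 m'9]; rewrite -val_eqE /= !inordK ?prednK //.
    by rewrite -(inj_eq succn_inj) !prednK.
  have y0 := ltn_trans x0 xy; have z0 := ltn_trans y0 yz.
  have y9 := ltn_trans yz z9; have x9 := ltn_trans xy y9.
  by rewrite !labE ?x0 ?y0 ?z0 ?n0.
have main x y z : sorted ltn [:: 0; x; y; z; 9]%N -> sorted ltn [:: 0; p; q; r; 9]%N ->
    (tri p q r == tri x y z) = ((p, q, r) == (x, y, z)).
  move=> sx sp; apply/eqP/eqP => [e|[-> -> ->] //].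
  have : mask p q r == mask x y z by rewrite -!tri_mask // e.
  move: (mem_triples8 sp) (mem_triples8 sx) => pin xin.
  suff : all (fun u => all (fun v => (mask u.1.1 u.1.2 u.2 == mask v.1.1 v.1.2 v.2)
    ==> (u == v)) triples8) triples8.
    by move=> /allP/(_ _ pin)/allP/(_ _ xin)/implyP h /h/eqP.
  by vm_compute.
by move=> sp; rewrite /nonbasis /nonbases_sp !inE !main // -!orbA.
Qed.

Section Labels.
Variable s : 'S_8.

(** Triples are named by the labels they have before [s] acts, so that the explicit computations do
    not depend on [s]. *)
Definition ltr (p q r : nat) : triple := tr3 (s (lab p)) (s (lab q)) (s (lab r)).

Definition is_nonbasis (l : triple) : bool := val (perm_triple s^-1 l) \in nonbases_sp.

Definition label (i : 'I_8) : nat := (s^-1%g i).+1.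

Lemma labK p : (0 < p < 9)%N -> label (s (lab p)) = p.
Proof. by move=> /andP [p0 p9]; rewrite /label permK /lab inordK ?prednK. Qed.

Lemma sorted_labels_bounds p q r : sorted ltn [:: 0; p; q; r; 9]%N ->
  [/\ (0 < p < 9)%N, (0 < q < 9)%N & (0 < r < 9)%N].
Proof.
rewrite /= andbT => /and4P [p0 pq qr r9].
rewrite p0 (ltn_trans pq (ltn_trans qr r9)) (ltn_trans p0 pq) (ltn_trans qr r9).
by rewrite (ltn_trans (ltn_trans p0 pq) qr) r9.
Qed.

Lemma lab_inj p q : (0 < p < 9)%N -> (0 < q < 9)%N -> (lab p == lab q) = (p == q).
Proof.
move=> p9 q9; apply/eqP/eqP => [e|-> //].
by rewrite -[p]labK // -[q]labK // e.
Qed.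

Lemma uniq_labels p q r : sorted ltn [:: 0; p; q; r; 9]%N ->
  uniq [:: lab p; lab q; lab r].
Proof.
move=> pqr; have [p9 q9 r9] := sorted_labels_bounds pqr; rewrite uniq3 !lab_inj //.
by move: pqr; rewrite /= andbT => /and4P [_ pq qr _]; rewrite !ltn_eqF ?(ltn_trans pq qr).
Qed.

Lemma uniq_labels_perm p q r : sorted ltn [:: 0; p; q; r; 9]%N ->
  uniq [:: s (lab p); s (lab q); s (lab r)].
Proof. by move/uniq_labels; rewrite !uniq3 !(inj_eq perm_inj). Qed.

Lemma is_nonbasis_ltr p q r : sorted ltn [:: 0; p; q; r; 9]%N ->
  is_nonbasis (ltr p q r) = nonbasis p q r.
Proof.
move=> pqr; rewrite /is_nonbasis /ltr perm_tr3 ?uniq_labels_perm // !permK.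
by rewrite val_tr3 ?uniq_labels // -mem_nonbases_sp.
Qed.

Lemma perm_tripleK l : perm_triple s (perm_triple s^-1 l) = l.
Proof.
apply: val_inj => /=; rewrite -imset_comp -[RHS]imset_id.
by apply: eq_imset => i /=; rewrite permKV.
Qed.

Lemma ltr_surj l : exists p q r, sorted ltn [:: 0; p; q; r; 9]%N /\ l = ltr p q r.
Proof.
have [i [j [k [ij jk lE]]]] := triple_sorted (perm_triple s^-1 l).
exists i.+1, j.+1, k.+1; split.
  by rewrite /= andbT; apply/and3P; split; [exact: ij | exact: jk | exact: (ltn_ord k)].
rewrite -[l]perm_tripleK lE /ltr /lab /= !inord_val perm_tr3 //.
by rewrite uniq3 -!val_eqE !ltn_eqF ?(ltn_trans ij jk).
Qed.

End Labels.

(** * Torus points lying over a realization of the configuration *)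

Section ConfigurationPoints.
Variable s : 'S_8.

Section Matrix.
Variable (F : fieldType).

Definition label_mx (c : nat -> nat -> F) : 'M[F]_(3, 8) :=
  \matrix_(i, j) c (label s j) i.

Lemma bracket_label_mx c p q r : sorted ltn [:: 0; p; q; r; 9]%N ->
  bracket (plucker (label_mx c)) (s (lab p)) (s (lab q)) (s (lab r)) = det3 c p q r.
Proof.
move=> pqr; rewrite bracket_plucker ?uniq_labels_perm //.
have [p9 q9 r9] := sorted_labels_bounds pqr.
by rewrite /det3 /column /label_mx !mxE !labK // !inordK.
Qed.

Lemma plucker_label_mx c p q r : sorted ltn [:: 0; p; q; r; 9]%N ->
  plucker (label_mx c) (ltr s p q r) =
  (-1) ^+ sign3 (s (lab p)) (s (lab q)) (s (lab r)) * det3 c p q r.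
Proof. by move=> pqr; rewrite -bracket_label_mx // /bracket signrMK. Qed.
End Matrix.

(* Weights of the torus coset: the eight column scalings act on the bases, and the
   coordinates of the nonbases are free. *)
Definition cexpo (l : triple) (j : 'I_8 + triple) : int :=
  match j with
  | inl i => (~~ is_nonbasis s l && (i \in val l))%:R
  | inr m => (is_nonbasis s l && (m == l))%:R
  end.

(** The base point of the coset. The value 1 at a nonbasis is an arbitrary unit, as the coordinate
    there is a free parameter. *)
Definition cbase (F : fieldType) (a : F) (l : triple) : F :=
  if is_nonbasis s l then 1 else plucker (label_mx (mk_col a)) l.

Lemma cbase_neq0 (F : fieldType) (a : F) l : a ^+ 2 - a + 1 = 0 -> cbase a l != 0.
Proof.
move=> ea; rewrite /cbase; case: ifPn => [_|]; first exact: oner_neq0.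
have [p [q [r [pqr ->]]]] := ltr_surj s l; rewrite is_nonbasis_ltr // => nb.
rewrite plucker_label_mx // mulf_neq0 ?signr_eq0 //.
have [e de] := mk_det_unit ea pqr nb.
by apply/eqP => d0; have := oner_neq0 F; rewrite -de d0 mul0r eqxx.
Qed.

Lemma prod_cexpo (k : fieldType) (t : 'I_8 + triple -> k) l :
  \prod_j t j ^ cexpo l j =
  if is_nonbasis s l then t (inr l) else \prod_(i in val l) t (inl i).
Proof.
rewrite big_sumType /=; case: ifP => _ /=.
  rewrite big1 ?mul1r => [|i _]; last by rewrite expr0z.
  rewrite (bigD1 l) //= eqxx expr1z big1 ?mulr1 // => m /negPf ->.
  by rewrite expr0z.
rewrite [X in _ * X]big1 ?mulr1 => [|i _]; last by rewrite expr0z.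
rewrite [RHS]big_mkcond; apply: eq_bigr => i _.
by case: (i \in _); rewrite ?expr1z ?expr0z.
Qed.

Lemma prod_ltr (k : fieldType) (t : 'I_8 -> k) p q r : sorted ltn [:: 0; p; q; r; 9]%N ->
  \prod_(i in val (ltr s p q r)) t i = t (s (lab p)) * t (s (lab q)) * t (s (lab r)).
Proof.
move=> pqr; have := uniq_labels_perm s pqr; rewrite uniq3 => /and3P [npq npr nqr].
rewrite val_tr3 ?uniq_labels_perm // finset.setUC big_setU1 ?big_setU1 ?big_set1 /=.
- by rewrite mulrC.
- by rewrite !inE.
- by rewrite !inE !(eq_sym (s (lab r))) negb_or npr.
Qed.

Section OverField.
Variables (k : fieldType) (x : triple -> k).
Hypothesis x_neq0 : forall l, x l != 0.

Let z l := if is_nonbasis s l then 0 else x l.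

Hypothesis z_rel : forall a b c d e : 'I_8, uniq [:: a; b; c; d; e] ->
  bracket z a b c * bracket z a d e - bracket z a b d * bracket z a c e +
  bracket z a b e * bracket z a c d = 0.

Ltac distinct i := by move: i; rewrite /= ?inE; lia.

(** The four ordered relations behind [mk_realization] are instances of [z_rel] with the repeated
    label in front; sorting the brackets only introduces signs. *)
Lemma configuration_point : exists (a c : k) (t : 'I_8 + triple -> k),
  [/\ a ^+ 2 - a + 1 = 0, c != 0, forall j, t j != 0 &
      forall l, x l = c * (cbase a l * \prod_j t j ^ cexpo l j)].
Proof.
pose g p q r := bracket z (s (lab p)) (s (lab q)) (s (lab r)).
pose ls n := s (lab n).
have sw12 i j m : uniq [:: i; j; m] -> bracket z j i m = - bracket z i j m.
  exact: bracket_swap12.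
have sw23 i j m : uniq [:: i; j; m] -> bracket z i m j = - bracket z i j m.
  exact: bracket_swap23.
have cyc i j m : uniq [:: i; j; m] -> bracket z m i j = bracket z i j m.
  move=> u; have u' : uniq [:: i; m; j].
    by move: u; rewrite !uniq3 (eq_sym m j) => /and3P [-> -> ->].
  by rewrite (sw12 _ _ _ u') (sw23 _ _ _ u) opprK.
have ls_uniq (r : seq nat) : all (fun n => 0 < n < 9)%N r -> uniq r -> uniq (map ls r).
  move=> /allP r9 ur; rewrite map_inj_in_uniq // => m n /r9 m9 /r9 n9.
  by move/perm_inj/eqP; rewrite (lab_inj s) // => /eqP.
have rel p q r u v : all (fun n => 0 < n < 9)%N [:: p; q; r; u; v] ->
    uniq [:: p; q; r; u; v] ->
    g p q r * g p u v - g p q u * g p r v + g p q v * g p r u = 0.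
  by move=> r9 ur; apply: z_rel; apply: (ls_uniq [:: p; q; r; u; v]).
have gsw p q r : all (fun n => 0 < n < 9)%N [:: p; q; r] -> uniq [:: p; q; r] ->
    g q p r = - g p q r.
  by move=> r9 ur; apply: sw12; apply: (ls_uniq [:: p; q; r]).
have gcyc p q r : all (fun n => 0 < n < 9)%N [:: p; q; r] -> uniq [:: p; q; r] ->
    g r p q = g p q r.
  by move=> r9 ur; apply: cyc; apply: (ls_uniq [:: p; q; r]).
have [a [c [t [ea c0 t0 gE]]]] : exists (a c : k) (t : nat -> k),
  [/\ a ^+ 2 - a + 1 = 0, c != 0, forall n, t n != 0 &
      forall p q r, sorted ltn [:: 0; p; q; r; 9]%N ->
        g p q r = c * (t p * t q * t r) * det3 (mk_col a) p q r].
  apply: mk_realization.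
  - by move=> p q r u v /= i; apply: rel; rewrite /= ?inE; lia.
  - move=> p q r u v /= i; have h : g q p r * g q u v - g q p u * g q r v + g q p v * g q r u = 0.
      by apply: rel; distinct i.
    apply: (sub_eq_of_eq0N h);
    have -> : g q p r = - g p q r by apply: gsw; distinct i.
    have -> : g q p u = - g p q u by apply: gsw; distinct i.
    have -> : g q p v = - g p q v by apply: gsw; distinct i.
    by ring.
  - move=> p q r u v /= i; have h : g r p q * g r u v - g r p u * g r q v + g r p v * g r q u = 0.
      by apply: rel; distinct i.
    apply: (sub_eq_of_eq0 h).
    have -> : g r p q = g p q r by apply: gcyc; distinct i.
    have -> : g r p u = - g p r u by apply: gsw; distinct i.
    have -> : g r q v = - g q r v by apply: gsw; distinct i.
    have -> : g r p v = - g p r v by apply: gsw; distinct i.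
    have -> : g r q u = - g q r u by apply: gsw; distinct i.
    by ring.
  - move=> p q r u v /= i; have h : g u p q * g u r v - g u p r * g u q v + g u p v * g u q r = 0.
      by apply: rel; distinct i.
    apply: (sub_eq_of_eq0N h).
    have -> : g u p q = g p q u by apply: gcyc; distinct i.
    have -> : g u r v = - g r u v by apply: gsw; distinct i.
    have -> : g u p r = g p r u by apply: gcyc; distinct i.
    have -> : g u q v = - g q u v by apply: gsw; distinct i.
    have -> : g u p v = - g p u v by apply: gsw; distinct i.
    have -> : g u q r = g q r u by apply: gcyc; distinct i.
    by ring.
  - move=> p q r nb; have pqr : sorted ltn [:: 0; p; q; r; 9]%N.
      by move: nb; rewrite /nonbasis !inE; repeat case/orP; move=> /eqP [-> -> ->].
    by rewrite /g /bracket /z -/(ltr s p q r) is_nonbasis_ltr // nb mulr0.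
  - move=> p q r pqr nb.
    by rewrite /g /bracket /z -/(ltr s p q r) is_nonbasis_ltr // (negPf nb) mulf_neq0 ?signr_eq0.
(* The overall factor [c] multiplies every coordinate, so it is divided out of the free ones. *)
pose T j := match j with inl i => t (label s i) | inr m => x m / c end.
exists a, c, T; split => //.
  by move=> [i|m]; rewrite /T ?mulf_neq0 ?invr_eq0.
move=> l; have [p [q [r [pqr ->]]]] := ltr_surj s l.
rewrite prod_cexpo /cbase is_nonbasis_ltr //.
case: ifPn => nb; first by rewrite mul1r /T mulrC divfK.
have [p9 q9 r9] := sorted_labels_bounds pqr.
rewrite prod_ltr // /T !labK // plucker_label_mx //.
have := gE _ _ _ pqr; rewrite /g /bracket /z -/(ltr s p q r) is_nonbasis_ltr // (negPf nb).
by move/(canRL (signrMK _)) => ->; ring.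
Qed.
End OverField.
End ConfigurationPoints.

(** * Initial forms of the three-term Pluecker relations *)

Section SparsePolynomials.
Variables (F : fieldType) (us : seq charlat) (c : charlat -> F).
Hypotheses (us_uniq : uniq us) (c_neq0 : forall u, u \in us -> c u != 0).

Let f : grpalg charlat F := \sum_(u <- us) mono u (c u).

Lemma mcoeff_sparse v : mcoeff v f = if v \in us then c v else 0.
Proof.
have mU u : mcoeff v (mono u (c u)) = if u == v then c v else 0.
  by rewrite /mono mcoeffU; case: eqP => [->|_]; rewrite ?mulr1n ?mulr0n.
have -> : mcoeff v f = \sum_(u <- us) mcoeff v (mono u (c u)).
  rewrite /f; elim/big_rec2: _ => [|u y1 y2 _ <-]; first exact: mcoeff0.
  exact: mcoeffD.
under eq_bigr do rewrite mU; rewrite -big_mkcond /=; case: ifP => vus.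
  by rewrite -big_filter (filter_pred1_uniq us_uniq vus) big_seq1.
rewrite big_seq_cond big1 // => u /andP [uus /eqP uv].
by rewrite uv vus in uus.
Qed.

Lemma msupp_sparse : perm_eq (msupp f) us.
Proof.
apply: uniq_perm => // v; rewrite -mcoeff_neq0 mcoeff_sparse.
by case: ifP => [/c_neq0|]; rewrite ?eqxx.
Qed.

Lemma ev_sparse (k : fieldType) (iota : {rmorphism F -> k}) x (P : pred charlat) :
  ev iota x (\sum_(u <- us | P u) mono u (c u)) =
  \sum_(u <- us | P u) iota (c u) * monom x u.
Proof. by rewrite raddf_sum; apply: eq_bigr => u _; apply: ev_monomial. Qed.

Lemma initial_form_sparse (R : realType) (w : triple -> R) :
  initial_form w f =
  \sum_(u <- us | all (fun v => pairing u w <= pairing v w) us) mono u (c u).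
Proof.
rewrite /initial_form (perm_big _ msupp_sparse) /= big_seq_cond [RHS]big_seq_cond.
apply: eq_big => [u|u /andP [uus _]]; first by rewrite (perm_all _ msupp_sparse).
by rewrite mcoeff_sparse uus.
Qed.
End SparsePolynomials.

Lemma uniq5 (T : eqType) (a b c d e : T) : uniq [:: a; b; c; d; e] ->
  [&& [&& a != b, a != c, a != d & a != e], [&& b != c, b != d & b != e],
      (c != d) && (c != e), d != e & true].
Proof. by rewrite /= !inE !negb_or. Qed.

Lemma uniq6 (T : eqType) (a b c d e g : T) : uniq [:: a; b; c; d; e; g] ->
  [&& [&& c != a, c != b & c != d], [&& e != a, e != b & e != g], c != e & c != g].
Proof.
rewrite /= !inE !negb_or => /and5P [/and5P [_ ac _ ae _] /and4P [bc _ be _]].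
move=> /and3P [cd ce cg] _ /andP [eg _].
by rewrite cd ce cg eg (eq_sym c) ac (eq_sym c) bc (eq_sym e) ae (eq_sym e) be.
Qed.

Section ThreeTerm.
Variables (F : fieldType) (R : realType) (s : 'S_8) (w a : triple -> R).
Variables (beta : 'I_8 -> R) (gamma : R).
Hypothesis wE : forall l, w l = a l + \sum_(i in val l) beta i + gamma.
Hypothesis a_ge0 : forall l, 0 <= a l.
Hypothesis a_gt0 : forall l, (0 < a l) = is_nonbasis s l.

(** The exponents of $x_{l_1}x_{l_2}/(x_{m_1}x_{m_2})$. *)
Definition quad_fun (l1 l2 m1 m2 : triple) : {ffun triple -> int} :=
  [ffun m => (m == l1)%:Z + (m == l2)%:Z - ((m == m1)%:Z + (m == m2)%:Z)].

Lemma quad_sum (V : pzRingType) (h : triple -> V) l1 l2 m1 m2 :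
  \sum_m (quad_fun l1 l2 m1 m2 m)%:~R * h m = h l1 + h l2 - (h m1 + h m2).
Proof.
have E (l' : triple) : \sum_m ((m == l')%:Z)%:~R * h m = h l'.
  rewrite (bigD1 l') //= eqxx mul1r big1 ?addr0 // => m /negPf ->.
  by rewrite mul0r.
have S (f1 f2 f3 f4 : triple -> V) : \sum_m (f1 m + f2 m - (f3 m + f4 m)) =
    \sum_m f1 m + \sum_m f2 m - (\sum_m f3 m + \sum_m f4 m).
  by rewrite big_split sumrN !big_split.
have dist (z1 z2 z3 z4 : int) (y : V) : (z1 + z2 - (z3 + z4))%:~R * y =
    z1%:~R * y + z2%:~R * y - (z3%:~R * y + z4%:~R * y).
  by rewrite intrB !intrD mulrBl !mulrDl.
rewrite -(E l1) -(E l2) -(E m1) -(E m2) -S; apply: eq_bigr => m _.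
by rewrite ffunE dist.
Qed.

Lemma quad_sum0 l1 l2 m1 m2 : quad_fun l1 l2 m1 m2 \in sum0.
Proof.
rewrite inE; apply/eqP; have := @quad_sum int (fun=> 1) l1 l2 m1 m2.
by under eq_bigr do rewrite mulr1 intz; rewrite subrr.
Qed.

Definition quad l1 l2 m1 m2 : charlat := Charlat (quad_sum0 l1 l2 m1 m2).

Lemma monom_quad (k : fieldType) (x : triple -> k) l1 l2 m1 m2 :
  (forall l, x l != 0) -> monom x (quad l1 l2 m1 m2) = x l1 * x l2 / (x m1 * x m2).
Proof.
move=> x0; have E (l' : triple) : \prod_m x m ^ (m == l')%:Z = x l'.
  rewrite (bigD1 l') //= eqxx expr1z big1 ?mulr1 // => m /negPf ->.
  by rewrite expr0z.
have S (f1 f2 f3 f4 : triple -> k) : \prod_m (f1 m * f2 m / (f3 m * f4 m)) =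
    (\prod_m f1 m * \prod_m f2 m) / (\prod_m f3 m * \prod_m f4 m).
  by rewrite big_split prodfV !big_split.
rewrite -(E l1) -(E l2) -(E m1) -(E m2) -S; apply: eq_bigr => m _.
by rewrite ffunE expfzDr // expfzDr // -invr_expz expfzDr.
Qed.

(** Both products use each label equally often, so the lineality part of [w] cancels. *)
Lemma pairing_quad (l1 l2 m1 m2 : triple) :
  (forall b : 'I_8 -> R, \sum_(i in val l1) b i + \sum_(i in val l2) b i =
             \sum_(i in val m1) b i + \sum_(i in val m2) b i) ->
  pairing (quad l1 l2 m1 m2) w = a l1 + a l2 - (a m1 + a m2).
Proof. by move=> h; rewrite /pairing quad_sum !wE; have := h beta; lra. Qed.

(** Needed so that the terms of a three-term relation, divided by its first product, do not
    merge. *)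
Lemma uniq_quad l1 m1 l2 m2 l3 m3 : uniq [:: l1; m1; l2; m2; l3; m3] ->
  uniq [:: 0; quad l2 m2 l1 m1; quad l3 m3 l1 m1].
Proof.
move=> /uniq6/and4P [/and3P [n1 n2 n3] /and3P [n4 n5 n6] n7 n8].
have v l l' m m' n : quad l l' m m' n = (n == l)%:Z + (n == l')%:Z - ((n == m)%:Z + (n == m')%:Z).
  by rewrite /= ffunE.
rewrite uniq3; apply/and3P; split; apply/eqP.
- move=> e; have := v l2 m2 l1 m1 l2; rewrite -e (charlat0 l2) eqxx.
  by rewrite (negPf n1) (negPf n2) (negPf n3).
- move=> e; have := v l3 m3 l1 m1 l3; rewrite -e (charlat0 l3) eqxx.
  by rewrite (negPf n4) (negPf n5) (negPf n6).
move=> e; have := v l2 m2 l1 m1 l2; rewrite e v eqxx.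
by rewrite (negPf n1) (negPf n2) (negPf n3) (negPf n7) (negPf n8).
Qed.

Section Relation.
Variables (k : fieldType) (iota : {rmorphism F -> k}) (x : triple -> k).
Hypothesis x_neq0 : forall l, x l != 0.
Hypothesis x_initial : forall g : grpalg charlat F, IGr0 g -> ev iota x (initial_form w g) = 0.

Let z l := if is_nonbasis s l then 0 else x l.

Let balanced (l m l' m' : triple) := forall b : 'I_8 -> R,
  \sum_(i in val l) b i + \sum_(i in val m) b i =
  \sum_(i in val l') b i + \sum_(i in val m') b i.

(* The initial form keeps the terms without nonbases, if there is one. *)
Lemma quadratic_relation l1 m1 l2 m2 l3 m3 (s1 s2 s3 : F) :
  uniq [:: l1; m1; l2; m2; l3; m3] -> s1 != 0 -> s2 != 0 -> s3 != 0 ->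
  balanced l2 m2 l1 m1 -> balanced l3 m3 l1 m1 ->
  (forall y : triple -> F, Gr0 y ->
     s1 * (y l1 * y m1) - s2 * (y l2 * y m2) + s3 * (y l3 * y m3) = 0) ->
  iota s1 * (z l1 * z m1) - iota s2 * (z l2 * z m2) + iota s3 * (z l3 * z m3) = 0.
Proof.
move=> /uniq_quad us_uniq s10 s20 s30 b2 b3 rel.
move: us_uniq (pairing_quad b2) (pairing_quad b3).
have := fun y => monom_quad l2 m2 l1 m1 y; have := fun y => monom_quad l3 m3 l1 m1 y.
move: (quad l2 m2 l1 m1) (quad l3 m3 l1 m1) => u2 u3 y3E y2E us_uniq p2 p3.
pose c u := if u == 0 then s1 else if u == u2 then - s2 else s3.
have [n2 n3 n23] : [/\ u2 == 0 = false, u3 == 0 = false & u3 == u2 = false].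
  by move: us_uniq; rewrite uniq3 !(eq_sym 0) (eq_sym u2 u3) =>
    /and3P [/negPf -> /negPf -> /negPf ->].
have big3 (V : nmodType) (P : pred charlat) (E : charlat -> V) :
    \sum_(u <- [:: 0; u2; u3] | P u) E u =
    (if P 0 then E 0 else 0) + ((if P u2 then E u2 else 0) + (if P u3 then E u3 else 0)).
  by rewrite big_mkcond !big_cons big_nil /= addr0.
have c_neq0 u : u \in [:: 0; u2; u3] -> c u != 0.
  by rewrite !inE /c; case: (u == 0) => //; case: (u == u2); rewrite ?oppr_eq0.
(* The relation divided by $x_{l_1}x_{m_1}$, which makes its exponents sum to 0. *)
pose f : grpalg charlat F := \sum_(u <- [:: 0; u2; u3]) mono u (c u).
have c1 : c 0 = s1 by rewrite /c eqxx.
have c2 : c u2 = - s2 by rewrite /c n2 eqxx.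
have c3 : c u3 = s3 by rewrite /c n3 n23.
have fI : IGr0 f.
  move=> y yGr; have [y0 _] := yGr; rewrite laurent_evalE /f ev_sparse big3 c1 c2 c3.
  rewrite monom0 y2E // y3E // /=.
  transitivity ((s1 * (y l1 * y m1) - s2 * (y l2 * y m2) + s3 * (y l3 * y m3)) / (y l1 * y m1)).
    by field; rewrite !y0.
  by rewrite rel // mul0r.
have := x_initial fI; rewrite (initial_form_sparse us_uniq c_neq0) ev_sparse big3.
have p1 : pairing 0 w = 0.
  by rewrite /pairing big1 // => l _; rewrite charlat0 mul0r.
rewrite /= !p1 p2 p3 c1 c2 c3 monom0 y2E // y3E // !lexx /= !andbT.
pose A1 := a l1 + a m1; pose A2 := a l2 + a m2; pose A3 := a l3 + a m3.
have zA (l m : triple) : z l * z m = if 0 < a l + a m then 0 else x l * x m.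
  have -> : (0 < a l + a m) = is_nonbasis s l || is_nonbasis s m.
    by rewrite -!a_gt0 !lt0r addr_ge0 // !a_ge0 !andbT paddr_eq0 // negb_and.
  by rewrite /z; do 2!case: ifP => //=; rewrite ?mul0r ?mulr0.
have A1_ge0 : 0 <= A1 by rewrite addr_ge0.
have A2_ge0 : 0 <= A2 by rewrite addr_ge0.
have A3_ge0 : 0 <= A3 by rewrite addr_ge0.
have x1 := x_neq0 l1; have x1' := x_neq0 m1.
rewrite !zA -/A1 -/A2 -/A3.
rewrite !subr_ge0 !subr_le0 !lerD2r mulr1.
have minP (A B C : R) : 0 <= A -> 0 <= B -> 0 <= C -> ~~ [&& 0 < A, 0 < B & 0 < C] ->
    (A <= B) && (A <= C) = ~~ (0 < A).
  move=> A0 B0 C0 n; rewrite -leNgt; apply/andP/idP => [[AB AC]|A0'].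
    by rewrite leNgt; apply: contra n => Ap; rewrite Ap !(lt_le_trans Ap).
  by rewrite !(le_trans A0').
(* If every product contains a nonbasis, [z] kills all three. Otherwise the minimal weight is 0, and
   the initial form consists of the products of bases. *)
have [/and3P [-> -> ->] _|n] := boolP [&& 0 < A1, 0 < A2 & 0 < A3].
  by rewrite !mulr0 subr0 addr0.
rewrite !minP //; last first.
- by apply: contra n => /and3P [-> -> ->].
- by apply: contra n => /and3P [-> -> ->].
move=> e; transitivity ((x l1 * x m1) * 0); last by rewrite mulr0.
rewrite -[0 in RHS]e; do 3!case: (0 < _) => /=; rewrite ?rmorphN; field; rewrite ?x1 ?x1' //.
Qed.

Lemma three_term_relation (i1 i2 i3 i4 i5 : 'I_8) : uniq [:: i1; i2; i3; i4; i5] ->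
  bracket z i1 i2 i3 * bracket z i1 i4 i5 - bracket z i1 i2 i4 * bracket z i1 i3 i5 +
  bracket z i1 i2 i5 * bracket z i1 i3 i4 = 0.
Proof.
move=> /uniq5/and5P [/and4P [n12 n13 n14 n15] /and3P [n23 n24 n25] /andP [n34 n35] n45 _].
have u2 i j : i1 != i -> i1 != j -> i != j -> uniq [:: i1; i; j].
  by move=> *; rewrite uniq3; apply/and3P.
have U := (u2 _ _ n12 n13 n23, u2 _ _ n12 n14 n24, u2 _ _ n12 n15 n25,
  u2 _ _ n13 n14 n34, u2 _ _ n13 n15 n35, u2 _ _ n14 n15 n45).
have term (F' : fieldType) (y : triple -> F') i j m i' j' m' :
    bracket y i j m * bracket y i' j' m' = (-1) ^+ sign3 i j m * (-1) ^+ sign3 i' j' m' *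
      (y (tr3 i j m) * y (tr3 i' j' m')) by rewrite /bracket mulrACA.
have signE i j m i' j' m' : iota ((-1) ^+ sign3 i j m * (-1) ^+ sign3 i' j' m') =
    (-1) ^+ sign3 i j m * (-1) ^+ sign3 i' j' m' by rewrite rmorphM !rmorph_sign.
have sum3 (b : 'I_8 -> R) i j m : uniq [:: i; j; m] ->
    \sum_(n in val (tr3 i j m)) b n = b i + b j + b m.
  move=> u; rewrite val_tr3 //; move: u; rewrite uniq3 => /and3P [ij im jm].
  rewrite finset.setUC big_setU1 ?big_setU1 ?big_set1 /=.
  - by rewrite addrC.
  - by rewrite !inE.
  - by rewrite !inE !(eq_sym m) negb_or im.
rewrite !term -!signE; apply: quadratic_relation; rewrite ?mulf_neq0 ?signr_eq0 //.
- have m3E i j m n : uniq [:: i; j; m] ->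
      (n \in val (tr3 i j m)) = [|| n == i, n == j | n == m].
    by move=> u; rewrite val_tr3 // !inE orbA.
  (* All six triples contain [i1]; membership of the other four labels tells them apart. *)
  suff : uniq (map (fun l : triple => [seq n \in val l | n <- [:: i2; i3; i4; i5]])
      [:: tr3 i1 i2 i3; tr3 i1 i4 i5; tr3 i1 i2 i4; tr3 i1 i3 i5; tr3 i1 i2 i5;
          tr3 i1 i3 i4]) by move/map_uniq.
  rewrite /= !m3E ?U //.
  have sy (i j : 'I_8) : i != j -> (j == i) = false by rewrite eq_sym => /negPf.
  rewrite !eqxx ?(negPf n12, negPf n13, negPf n14, negPf n15, negPf n23, negPf n24,
    negPf n25, negPf n34, negPf n35, negPf n45).
  by rewrite ?(sy _ _ n12, sy _ _ n13, sy _ _ n14, sy _ _ n15, sy _ _ n23, sy _ _ n24,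
    sy _ _ n25, sy _ _ n34, sy _ _ n35, sy _ _ n45).
- by move=> b; rewrite !sum3 ?U //; ring.
- by move=> b; rewrite !sum3 ?U //; ring.
move=> y [_ [A _ ->]]; rewrite -!term !bracket_plucker ?U // /det3; ring.
Qed.
End Relation.

End ThreeTerm.

(** * Deforming a realization with prescribed minors at the nonbases *)

Section NearbyRoot.
Variable K : numClosedFieldType.

(** The value at [y] is the product of the differences to the two roots, and its absolute value is
    at least the square of the smaller distance. *)
Lemma quadratic_near_root (b c y : K) :
  exists r, r ^+ 2 + b * r + c = 0 /\ `|y - r| ^+ 2 <= `|y ^+ 2 + b * y + c|.
Proof.
pose d := sqrtC (b ^+ 2 - 4 * c); have dd : d ^+ 2 = b ^+ 2 - 4 * c by rewrite sqrtCK.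
pose r1 := (- b + d) / 2; pose r2 := (- b - d) / 2.
have n2 : 2 != 0 :> K by rewrite pnatr_eq0.
have cE : c = (b ^+ 2 - d ^+ 2) / 4 by rewrite dd; field.
have q z : z ^+ 2 + b * z + c = (z - r1) * (z - r2) by rewrite cE /r1 /r2; field.
have [le|le] := real_leP (normr_real (y - r1)) (normr_real (y - r2)).
  exists r1; rewrite !q subrr mul0r; split => //.
  by rewrite normrM expr2 ler_wpM2l.
exists r2; rewrite !q subrr mulr0; split => //.
by rewrite normrM expr2 ler_wpM2r // ltW.
Qed.
End NearbyRoot.

Section Arc.
Variables (K : numClosedFieldType) (alpha : K) (delta : nat -> nat -> nat -> nat -> K).
Hypothesis alphaE : alpha ^+ 2 - alpha + 1 = 0.
Hypothesis delta0 : forall p q r, nonbasis p q r -> delta p q r n @[n --> \oo] --> (0 : K).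

Lemma cvg_eqr (f : nat -> K) (x y : K) : f n @[n --> \oo] --> x -> x = y ->
  f n @[n --> \oo] --> y.
Proof. by move=> ? <-. Qed.

Lemma cvg_near_neq0 (f : nat -> K) (x : K) : x != 0 -> f n @[n --> \oo] --> x ->
  \forall n \near \oo, f n != 0.
Proof. by move=> x0 /cvgr_neq0; apply. Qed.

Lemma cvg_seqD (f g : nat -> K) (x y : K) : f n @[n --> \oo] --> x ->
  g n @[n --> \oo] --> y -> f n + g n @[n --> \oo] --> x + y.
Proof. exact: cvgD. Qed.

Lemma cvg_seqB (f g : nat -> K) (x y : K) : f n @[n --> \oo] --> x ->
  g n @[n --> \oo] --> y -> f n - g n @[n --> \oo] --> x - y.
Proof. exact: cvgB. Qed.

Lemma cvg_seqM (f g : nat -> K) (x y : K) : f n @[n --> \oo] --> x ->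
  g n @[n --> \oo] --> y -> f n * g n @[n --> \oo] --> x * y.
Proof. exact: cvgM. Qed.

Lemma cvg_seqV (f : nat -> K) (x : K) : x != 0 -> f n @[n --> \oo] --> x ->
  (f n)^-1 @[n --> \oo] --> x^-1.
Proof. exact: cvgV. Qed.

(** Columns 1 to 4 stay fixed, and seven of the eight equations are solved directly for entries of
    columns 5 to 8. The equation for 567 then becomes quadratic in the entry [A], with coefficients
    tending to those of the equation of [alpha], so it has a root tending to [alpha]. *)
Lemma mk_arc : exists col : nat -> nat -> nat -> K,
  (forall p i, col n p i @[n --> \oo] --> mk_col alpha p i) /\
  \forall n \near \oo, forall p q r, nonbasis p q r ->
    det3 (col n) p q r = delta p q r n.
Proof.
pose s1 := delta 2 3 5; pose s2 := delta 1 4 5; pose s3 := delta 1 2 6.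
(* The minor 248 is minus the perturbation of the last entry of column 8. *)
pose s4 := delta 3 4 7; pose s5 n := - delta 2 4 8 n; pose s6 := delta 3 6 8.
pose s7 := delta 1 7 8; pose s8 := delta 5 6 7.
have h1 : s1 n @[n --> \oo] --> (0 : K) by apply: delta0.
have h2 : s2 n @[n --> \oo] --> (0 : K) by apply: delta0.
have h3 : s3 n @[n --> \oo] --> (0 : K) by apply: delta0.
have h4 : s4 n @[n --> \oo] --> (0 : K) by apply: delta0.
have h5 : s5 n @[n --> \oo] --> (0 : K).
  by apply: (cvg_eqr _ (oppr0 _)); apply: cvgN; apply: delta0.
have h6 : s6 n @[n --> \oo] --> (0 : K) by apply: delta0.
have h7 : s7 n @[n --> \oo] --> (0 : K) by apply: delta0.
have h8 : s8 n @[n --> \oo] --> (0 : K) by apply: delta0.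
have c1 (x : K) : x @[n --> \oo] --> x by apply: cvg_cst.
pose B n := (1 + s4 n) * (1 + s5 n) - s7 n.
have hB : B n @[n --> \oo] --> (1 : K).
  apply: (@cvg_eqr _ ((1 + 0) * (1 + 0) - 0)); last by ring.
  exact: (cvg_seqB (cvg_seqM (cvg_seqD (c1 1) h4) (cvg_seqD (c1 1) h5)) h7).
pose E n := (1 + s4 n) * (1 + s2 n) + s3 n - s8 n - s1 n * (1 + s4 n) * s3 n.
have hE : E n @[n --> \oo] --> (1 : K).
  apply: (@cvg_eqr _ ((1 + 0) * (1 + 0) + 0 - 0 - 0 * (1 + 0) * 0)); last by ring.
  apply: cvg_seqB; last exact: (cvg_seqM (cvg_seqM h1 (cvg_seqD (c1 1) h4)) h3).
  exact: (cvg_seqB (cvg_seqD (cvg_seqM (cvg_seqD (c1 1) h4) (cvg_seqD (c1 1) h2)) h3) h8).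
(* [b] and [c] are the coefficients of the equation for 567, multiplied by the denominator
   [A n + s6 n] and made monic. *)
pose b n := ((1 + s2 n) * s6 n - s1 n * B n - E n) / (1 + s2 n).
pose c n := (B n - s6 n * E n) / (1 + s2 n).
have h2' : 1 + s2 n @[n --> \oo] --> (1 + 0 : K) by apply: cvg_seqD.
have n10 : 1 + 0 != 0 :> K by rewrite addr0 oner_eq0.
have hV : (1 + s2 n)^-1 @[n --> \oo] --> ((1 + 0)^-1 : K) := cvg_seqV n10 h2'.
have hb : b n @[n --> \oo] --> (-1 : K).
  apply: (@cvg_eqr _ (((1 + 0) * 0 - 0 * 1 - 1) * (1 + 0)^-1)); last by field.
  exact: (cvg_seqM (cvg_seqB (cvg_seqB (cvg_seqM h2' h6) (cvg_seqM h1 hB)) hE) hV).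
have hc : c n @[n --> \oo] --> (1 : K).
  apply: (@cvg_eqr _ ((1 - 0 * 1) * (1 + 0)^-1)); last by field.
  exact: (cvg_seqM (cvg_seqB hB (cvg_seqM h6 hE)) hV).
have /choice [A AE] n := quadratic_near_root (b n) (c n) alpha.
have hA : A n @[n --> \oo] --> alpha.
  have hq : alpha ^+ 2 + b n * alpha + c n @[n --> \oo] --> (0 : K).
    apply: (@cvg_eqr _ (alpha ^+ 2 + (-1) * alpha + 1)); last by rewrite -alphaE; ring.
    exact: (cvg_seqD (cvg_seqD (c1 _) (cvg_seqM hb (c1 alpha))) hc).
  apply/cvgrPdist_lt => e e0.
  have e2 : 0 < e ^+ 2 by rewrite exprn_gt0.
  have /cvgrPdist_lt/(_ _ e2) := hq; apply: filterS => n; rewrite sub0r normrN => lt.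
  by rewrite -(ltr_pXn2r (n := 2)) ?nnegrE ?(ltW e0) //; apply: le_lt_trans lt; case: (AE n).
(* Hence the last entry [B n / G n] of column 7 tends to [1 - alpha], as in [mk_col]. *)
have alpha_inv : alpha * (1 - alpha) = 1 by apply: (sub_eq_of_eq0N alphaE); ring.
have alpha0 : alpha != 0.
  by apply/eqP => a0; move: alpha_inv (oner_neq0 K); rewrite a0 mul0r => <-; rewrite eqxx.
pose G n := A n + s6 n.
have hG : G n @[n --> \oo] --> alpha.
  by apply: (@cvg_eqr _ (alpha + 0)); [exact: (cvg_seqD hA h6) | rewrite addr0].
have hGV : (G n)^-1 @[n --> \oo] --> alpha^-1 := cvg_seqV alpha0 hG.
pose col n (p i : nat) : K := nth 0 (nth [::] [:: [::]; [:: 1; 0; 0]; [:: 0; 1; 0];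
  [:: 0; 0; 1]; [:: 1; 1; 1]; [:: s1 n; 1; 1 + s2 n]; [:: 1; A n; s3 n];
  [:: 1; 1 + s4 n; B n / G n]; [:: 1; G n; 1 + s5 n]] p) i.
exists col; split.
  have hBG : B n / G n @[n --> \oo] --> 1 - alpha.
    apply: (@cvg_eqr _ (1 * alpha^-1)); first exact: (cvg_seqM hB hGV).
    by apply: (mulfI alpha0); rewrite mul1r mulfV // alpha_inv.
  have one (f : nat -> K) : f n @[n --> \oo] --> (0 : K) -> 1 + f n @[n --> \oo] --> (1 : K).
    by move=> f0; apply: (@cvg_eqr _ (1 + 0)); [exact: (cvg_seqD (c1 1) f0) | exact: addr0].
  have h2'' := one _ h2; have h4' := one _ h4; have h5' := one _ h5.
  move=> p i; rewrite /col /mk_col; do 9?[case: p => [|p]]; do 3?[case: i => [|i]] => /=;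
    first [exact: c1 | exact: h1 | exact: h2'' | exact: h3 | exact: h4' | exact: h5'
      | exact: hA | exact: hG | exact: hBG].
have n2 := cvg_near_neq0 n10 h2'; have nG := cvg_near_neq0 alpha0 hG.
near=> n.
have s2n : 1 + s2 n != 0 by near: n.
have Gn : G n != 0 by near: n.
(* The left side is the minor 567; clearing denominators recovers the quadratic equation. *)
have AG : s1 n * (A n * (B n / G n) - (1 + s4 n) * s3 n) - B n / G n +
    (1 + s4 n) * (1 + s2 n) + s3 n - A n * (1 + s2 n) = s8 n.
  have [Aq _] := AE n; apply: (mulIf (mulf_neq0 Gn s2n)).
  apply: (sub_eq_of_eq0M (c := - (1 + s2 n) ^+ 2) Aq).
  rewrite /b /c /E /G; field; rewrite s2n; exact: Gn.
move=> p q r; rewrite /nonbasis !inE => /or4P [|||/or4P [|||/orP []]] => /eqP [-> -> ->];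
  rewrite /det3 /col /=.
- by rewrite -/(s3 n); ring.
- by rewrite -/(s2 n); ring.
- by rewrite /B -/(s7 n); field.
- by rewrite -/(s1 n); ring.
- by rewrite /s5; ring.
- by rewrite -/(s4 n); ring.
- by rewrite /G -/(s6 n); ring.
by rewrite -/(s8 n) -AG; ring.
Unshelve. all: by end_near.
Qed.
End Arc.

(** * Initial forms as limits along rescaled points of the Grassmannian *)

Section SequenceLimits.
Variable K : numFieldType.
Implicit Types (f : nat -> K) (x : K).

Lemma cvg_seq_sum (I : Type) (r : seq I) (F : I -> nat -> K) (l : I -> K) :
  (forall i, F i n @[n --> \oo] --> l i) ->
  \sum_(i <- r) F i n @[n --> \oo] --> \sum_(i <- r) l i.
Proof.
move=> h; elim: r => [|i r IH].
  by under eq_fun do rewrite big_nil; rewrite big_nil; apply: cvg_cst.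
by under eq_fun do rewrite big_cons; rewrite big_cons; apply: cvgD.
Qed.

Lemma cvg_seq_prod (I : Type) (r : seq I) (F : I -> nat -> K) (l : I -> K) :
  (forall i, F i n @[n --> \oo] --> l i) ->
  \prod_(i <- r) F i n @[n --> \oo] --> \prod_(i <- r) l i.
Proof.
move=> h; elim: r => [|i r IH].
  by under eq_fun do rewrite big_nil; rewrite big_nil; apply: cvg_cst.
by under eq_fun do rewrite big_cons; rewrite big_cons; apply: cvgM.
Qed.

Lemma cvg_seq_expz f x (m : int) : x != 0 -> f n @[n --> \oo] --> x ->
  f n ^ m @[n --> \oo] --> x ^ m.
Proof.
move=> x0 fx; have pow (k : nat) : f n ^+ k @[n --> \oo] --> x ^+ k.
  elim: k => [|k IH]; first exact: cvg_cst.
  by under eq_fun do rewrite exprS; rewrite exprS; apply: cvgM.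
case: m => k; first exact: pow.
by apply: (cvgV _ (pow k.+1)); rewrite expf_neq0.
Qed.

Lemma cvg_monom (y : nat -> triple -> K) (x : triple -> K) (u : charlat) :
  (forall l, x l != 0) -> (forall l, y n l @[n --> \oo] --> x l) ->
  monom (y n) u @[n --> \oo] --> monom x u.
Proof. by move=> x0 yx; apply: cvg_seq_prod => l; apply: cvg_seq_expz. Qed.
End SequenceLimits.

Lemma plucker_row_free (F : fieldType) (A : 'M[F]_(3, 8)) l :
  plucker A l != 0 -> row_free A.
Proof.
pose g (j : 'I_3) := nth ord0 (enum (val l)) j; rewrite /plucker -/g => d0.
have : colsub g A \in unitmx by rewrite unitmxE unitfE.
rewrite -row_free_unit /row_free => /eqP r3; rewrite eqn_leq rank_leq_row /=.
by rewrite -{1}r3 -[A in colsub g A]mulmx1 -mulmx_colsub mxrankM_maxl.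
Qed.

Lemma plucker_scale (F : fieldType) (A : 'M[F]_(3, 8)) (d : 'I_8 -> F) l :
  plucker (\matrix_(i, j) (d j * A i j)) l = \prod_(i in val l) d i * plucker A l.
Proof.
have [i [j [m [ij jm ->]]]] := triple_sorted l.
have [nij njm nim] : [/\ i != j, j != m & i != m].
  by rewrite -!val_eqE !neq_ltn ij jm (ltn_trans ij jm).
rewrite !plucker_sorted // val_tr3 ?uniq3 ?nij ?njm ?nim //.
rewrite finset.setUC big_setU1 ?big_setU1 ?big_set1 /=.
- by rewrite /det3 /column !mxE; ring.
- by rewrite !inE.
- by rewrite !inE !(eq_sym m) negb_or nim.
Qed.

Lemma seq_argmin (R : realDomainType) (T : eqType) (h : T -> R) (r : seq T) x :
  x \in r -> exists2 y, y \in r & forall z, z \in r -> h y <= h z.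
Proof.
elim: r x => // y r IH x _; case: r IH => [_|y' r IH].
  by exists y; rewrite ?mem_head // => z; rewrite inE => /eqP ->.
have [m mr mmin] := IH y' (mem_head _ _).
have [le|lt] := leP (h y) (h m).
  exists y; rewrite ?mem_head // => z; rewrite inE => /orP [/eqP -> //|/mmin].
  exact: le_trans.
exists m; first by rewrite inE mr orbT.
by move=> z; rewrite inE => /orP [/eqP ->|/mmin //]; apply: ltW.
Qed.

Section Limit.
Variables (R : realType) (K : numClosedFieldType) (tau : R -> nat -> K).
(** [tau x n] stands for $\varepsilon_n^x$, where $\varepsilon_n$ tends to 0. *)
Hypothesis tauD : forall x y n, tau (x + y) n = tau x n * tau y n.
Hypothesis tau_neq0 : forall x n, tau x n != 0.
Hypothesis tau_cvg0 : forall x, 0 < x -> tau x n @[n --> \oo] --> (0 : K).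

Let tau0 n : tau 0 n = 1.
Proof. by apply: (mulfI (tau_neq0 0 n)); rewrite -tauD addr0 mulr1. Qed.

Let tau_sum (I : Type) (r : seq I) (P : pred I) (h : I -> R) n :
  tau (\sum_(i <- r | P i) h i) n = \prod_(i <- r | P i) tau (h i) n.
Proof. exact: (big_morph (fun x => tau x n) (fun x y => tauD x y n) (tau0 n)). Qed.

Let tauXz x (m : int) n : tau (m%:~R * x) n = tau x n ^ m.
Proof.
have pow (k : nat) : tau (k%:R * x) n = tau x n ^+ k.
  by elim: k => [|k IH]; rewrite ?mul0r ?tau0 // mulrS mulrDl mul1r tauD IH exprS.
case: m => k; first exact: pow.
apply: (mulIf (tau_neq0 (k.+1%:R * x) n)).
by rewrite -tauD NegzE mulrNz mulNr addNr tau0 pow -exprnN mulVf ?expf_neq0.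
Qed.

Lemma monom_tau (w : triple -> R) u n : monom (fun l => tau (w l) n) u = tau (pairing u w) n.
Proof. by rewrite /pairing tau_sum; apply: eq_bigr => l _; rewrite tauXz. Qed.

Variables (s : 'S_8) (w a : triple -> R) (beta : 'I_8 -> R) (gamma : R).
Hypothesis wE : forall l, w l = a l + \sum_(i in val l) beta i + gamma.
Hypothesis a_ge0 : forall l, 0 <= a l.
Hypothesis a_gt0 : forall l, (0 < a l) = is_nonbasis s l.
Variable alpha : K.
Hypothesis alphaE : alpha ^+ 2 - alpha + 1 = 0.

Let w0 l := a l + \sum_(i in val l) beta i.

Let pairing_w u : pairing u w = pairing u w0.
Proof.
rewrite -(pairing_shift u w0 gamma); apply: eq_bigr => l _.
by rewrite wE.
Qed.

(** Scaling column [j] by [tau (beta j)] accounts for the lineality part of the weight. At bases the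
    remaining weight is 0 and the minors converge; at nonbases the minors are prescribed by [mk_arc]
    so as to cancel the rest. *)
Lemma arc_to_point (t : 'I_8 + triple -> K) : (forall j, t j != 0) ->
  exists A : nat -> 'M[K]_(3, 8), forall l,
    plucker (A n) l / tau (w0 l) n @[n --> \oo] -->
      tpoint (cexpo s) (cbase s alpha) idfun t l.
Proof.
move=> t0; pose tl (l : triple) := \prod_(i in val l) t (inl i).
have tl0 l : tl l != 0 by apply/prodf_neq0.
pose sg p q r : K := (-1) ^+ sign3 (s (lab p)) (s (lab q)) (s (lab r)).
(* The minor for which the rescaled coordinate equals [t (inr _)]; it tends to 0 because [a] is
   positive at nonbases. *)
pose delta p q r n := sg p q r * (t (inr (ltr s p q r)) / tl (ltr s p q r)) *
  tau (a (ltr s p q r)) n.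
have nb_sorted p q r : nonbasis p q r -> sorted ltn [:: 0; p; q; r; 9]%N.
  by rewrite /nonbasis !inE; repeat case/orP; move=> /eqP [-> -> ->].
have delta0 p q r : nonbasis p q r -> delta p q r n @[n --> \oo] --> (0 : K).
  move=> nb; rewrite -[0](mulr0 (sg p q r * (t (inr (ltr s p q r)) / tl (ltr s p q r)))).
  apply: cvg_seqM; first exact: cvg_cst.
  by apply: tau_cvg0; rewrite a_gt0 is_nonbasis_ltr ?nb ?nb_sorted.
have [col [col_cvg col_nb]] := mk_arc alphaE delta0.
pose A n : 'M[K]_(3, 8) :=
  \matrix_(i, j) ((t (inl j) * tau (beta j) n) * label_mx s (col n) i j).
have AE n l : plucker (A n) l / tau (w0 l) n =
    tl l * plucker (label_mx s (col n)) l / tau (a l) n.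
  rewrite plucker_scale big_split /= -tau_sum /w0 tauD -/(tl l).
  by field; rewrite !tau_neq0.
exists A => l; have [p [q [r [pqr lE]]]] := ltr_surj s l.
have [nb|nb] := boolP (is_nonbasis s l).
  have -> : tpoint (cexpo s) (cbase s alpha) idfun t l = t (inr l).
    by rewrite /tpoint prod_cexpo /cbase nb mul1r.
  apply: cvg_near_cst; apply: filterS col_nb => n nbE; rewrite AE.
  rewrite lE plucker_label_mx // nbE -?(is_nonbasis_ltr s pqr) -?lE // /delta -lE.
  rewrite -/(sg p q r); transitivity (sg p q r ^+ 2 * t (inr l)).
    by field; rewrite tl0 tau_neq0.
  by rewrite sqrr_sign mul1r.
have -> : tpoint (cexpo s) (cbase s alpha) idfun t l =
    tl l * (sg p q r * det3 (mk_col alpha) p q r).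
  by rewrite /tpoint prod_cexpo /cbase (negPf nb) mulrC; congr (_ * _);
    rewrite lE -plucker_label_mx.
have a0 : a l = 0.
  by apply/eqP; rewrite eq_le a_ge0 andbT leNgt a_gt0.
have -> : (fun n => plucker (A n) l / tau (w0 l) n) =
    (fun n => tl l * (sg p q r * det3 (col n) p q r)).
  apply/funext => n; rewrite AE a0 tau0 divr1; congr (_ * _).
  by rewrite lE plucker_label_mx.
apply: cvg_seqM; first exact: cvg_cst.
apply: cvg_seqM; first exact: cvg_cst.
rewrite /det3; apply: cvg_seqD; first apply: cvg_seqB; apply: cvg_seqM => //;
  by apply: cvg_seqB; apply: cvg_seqM.
Qed.

(** In $f = 0$ at the arc, divided by [tau m] for the minimal weight [m], the terms of larger weight
    tend to 0 and the others to the terms of the initial form. *)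
Lemma initial_form_coset f : IGr0 f ->
  forall t, (forall j, t j != 0) ->
  ev idfun (tpoint (cexpo s) (cbase s alpha) idfun t) (initial_form w f) = 0.
Proof.
move=> fI t t0; set x := tpoint _ _ _ _.
have x0 : forall l, x l != 0.
  by apply: (tpoint_neq0 (cexpo s) (fun l => cbase_neq0 s l alphaE) idfun).
have [A Acvg] := arc_to_point t0; rewrite -/x in Acvg.
pose X n l := plucker (A n) l / tau (w0 l) n.
have Gr n : (forall l, X n l != 0) -> Gr0 (plucker (A n)).
  move=> Xn; have An l : plucker (A n) l != 0.
    by have := Xn l; rewrite /X mulf_eq0 negb_or => /andP [].
  by split => //; exists (A n) => //; apply: (@plucker_row_free _ _ default_triple).
(* The limit lies in the torus, so the arc eventually lies in the open locus [Gr0]. *)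
have Xnear : \forall n \near \oo, forall l, X n l != 0.
  by apply: filter_forall => l; apply: (cvg_near_neq0 (x0 l)); apply: Acvg.
(* [m] is the minimal weight on the support of [f], with 0 as a dummy value for empty support. *)
have [m mmin mE] : exists2 m, forall u, u \in msupp f -> m <= pairing u w &
    forall u, u \in msupp f ->
      all (fun v => pairing u w <= pairing v w) (msupp f) = (pairing u w == m).
  have [e|[u0 u0f]] : msupp f = fset0 \/ exists u0, u0 \in msupp f.
    by have [->|/fset0Pn] := eqVneq (msupp f) fset0; [left|right].
    by exists 0 => u; rewrite e.
  have [u1 u1f u1min] : exists2 u1, u1 \in msupp f &
      forall u, u \in msupp f -> pairing u1 w <= pairing u w.
    exact: (seq_argmin (fun u => pairing u w) u0f).
  exists (pairing u1 w) => // u uf; rewrite eq_le u1min // andbT.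
  apply/allP/idP => [/(_ _ u1f) //|le v vf].
  exact: le_trans le (u1min v vf).
have zero : \forall n \near \oo, \sum_(u <- msupp f)
    mcoeff u f * (monom (X n) u * tau (pairing u w - m) n) = 0.
  apply: filterS Xnear => n Xn.
  have := fI _ (Gr n Xn); rewrite laurent_evalE /ev => e.
  transitivity ((\sum_(u <- msupp f) mcoeff u f * monom (plucker (A n)) u) * tau (- m) n).
    rewrite mulr_suml; apply: eq_bigr => u _; rewrite tauD mulrA mulrA; congr (_ * _).
    rewrite pairing_w -monom_tau -mulrA -monomM; congr (_ * monom _ _).
    by apply/funext => l; rewrite /X divfK.
  by rewrite [X in X * _]e mul0r.
have lim : \sum_(u <- msupp f) mcoeff u f * (monom (X n) u * tau (pairing u w - m) n)
    @[n --> \oo] --> \sum_(u <- msupp f) mcoeff u f *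
      (monom x u * (pairing u w == m)%:R).
  apply: cvg_seq_sum => u; have [uf|/mcoeff_outdom ->] := boolP (u \in msupp f); last first.
    by rewrite mul0r; under eq_fun do rewrite mul0r; apply: cvg_cst.
  apply: cvg_seqM; first exact: cvg_cst.
  apply: cvg_seqM; first exact: (@cvg_monom _ X x u x0 Acvg).
  case: eqP => [->|/eqP um]; rewrite ?subrr.
    by under eq_fun do rewrite tau0; apply: cvg_cst.
  by apply: tau_cvg0; rewrite subr_gt0 lt_neqAle eq_sym um mmin.
have lim0 : \sum_(u <- msupp f) mcoeff u f * (monom (X n) u * tau (pairing u w - m) n)
    @[n --> \oo] --> (0 : K) by apply: cvg_near_cst.
rewrite -[RHS](cvg_unique _ lim lim0); last exact: norm_hausdorff.
rewrite /initial_form raddf_sum big_seq_cond big_mkcondr /= -big_seq.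
rewrite [RHS]big_seq [LHS]big_seq; apply: eq_bigr => u uf.
rewrite mE //; case: eqP => _; last by rewrite mulr0 mulr0.
by rewrite ev_monomial mulr1.
Qed.
End Limit.

(** * Connected components of a closed set of primes *)

Section TwoComponents.
Variables (A : comNzRingType) (E : set A) (P1 P2 : Spec A).
Hypotheses (ZP1 : zeros E P1) (ZP2 : zeros E P2).
Hypothesis cover : forall P, zeros E P ->
  (forall f, P1 f -> P f) \/ (forall f, P2 f -> P f).
Hypothesis disjoint : forall P : Spec A,
  (forall f, P1 f -> P f) -> (forall f, P2 f -> P f) -> False.

Let above (Q : Spec A) : set (Spec A) := zeros [set f | Q f].

Lemma zeros_closed (D : set A) : closed (zeros D).
Proof. by rewrite -[zeros D]setCK; apply: open_closedC; exists D. Qed.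

(* A closed set of primes containing Q contains every prime above Q. *)
Lemma above_connected Q : zeros E Q -> connected (zeros E `&` above Q).
Proof.
move=> ZQ B [P BP] [U [D UE] BU] [C Ccl BC].
have [D' CE] : exists D', C = zeros D'.
  have [D' CE] : open (~` C) by apply: closed_openC.
  by exists D'; rewrite -[C]setCK CE setCK.
have QB : B Q.
  rewrite BU; split; first by split => // f.
  rewrite UE => QD; have : B P by [].
  by rewrite BU UE => -[[_ QP] nPD]; apply: nPD => f /QD /QP.
rewrite BC; apply/seteqP; split => [P' [] //|P' [ZP' QP']]; split => //.
by move: QB; rewrite BC CE => -[_ QD'] f /QD' /QP'.
Qed.

(** The primes above [Q] form a connected set, which is closed and, as the complement of the primes
    above [Q'], also open in [zeros E]. *)
Lemma component_above (Q Q' : Spec A) :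
  zeros E Q -> (forall P, zeros E P -> (forall f, Q f -> P f) \/ (forall f, Q' f -> P f)) ->
  (forall P : Spec A, (forall f, Q f -> P f) -> (forall f, Q' f -> P f) -> False) ->
  forall P, zeros E P -> (forall f, Q f -> P f) ->
  connected_component (zeros E) P = zeros E `&` above Q.
Proof.
move=> ZQ cov dis P ZP QP; apply/seteqP; split; last first.
  apply: connected_component_max => //.
  exact: above_connected.
have aboveE : zeros E `&` above Q = zeros E `&` ~` above Q'.
  apply/seteqP; split => P' [ZP' h]; split => //; first by move=> h'; apply: dis h h'.
  by have [|/h] := cov P' ZP'.
pose K := connected_component (zeros E) P.
have KZ : K `<=` zeros E by apply: connected_component_sub.
suff KE : K `&` above Q = K by rewrite -/K -KE => P' [KP' QP']; split => //; apply: KZ.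
(* A nonempty subset of the component that is both open and closed in it is all of it. *)
apply: (@component_connected _ (zeros E) P).
- by exists P; split => //; apply: connected_component_refl.
- exists (~` above Q'); first exact/closed_openC/zeros_closed.
  apply/seteqP; split => P' [KP' h]; split => //.
    by have [] : (zeros E `&` ~` above Q') P' by rewrite -aboveE; split => //; apply: KZ.
  by have [] : (zeros E `&` above Q) P' by rewrite aboveE; split => //; apply: KZ.
- by exists (above Q) => //; apply: zeros_closed.
Qed.

Lemma two_components : (components (zeros E) #= `I_2)%card.
Proof.
pose Z1 := zeros E `&` above P1; pose Z2 := zeros E `&` above P2.
have c1 := component_above ZP1 cover disjoint.
have c2 : forall P, zeros E P -> (forall f, P2 f -> P f) ->
    connected_component (zeros E) P = Z2.
  apply: (@component_above P2 P1) => // [P /cover [] h|P h h']; [by right|by left|].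
  exact: disjoint h' h.
have nZ : Z1 <> Z2.
  move=> e; have : Z1 P1 by split.
  by rewrite e => -[_ P21]; apply: (@disjoint P1).
have compE : components (zeros E) = [set Z1; Z2].
  apply/seteqP; split => [_ [P ZP <-]|_ [->|->]].
  - by have [h|h] := cover ZP; [left; apply: c1|right; apply: c2].
  - by exists P1 => //; apply: c1.
  - by exists P2 => //; apply: c2.
have nZ' : Z2 <> Z1 by move/esym.
rewrite compE; apply/card_set_bijP; exists (fun X => if pselect (X = Z1) then 0%N else 1%N).
split.
- by move=> X _ /=; case: pselect.
- move=> X Y; rewrite !inE /= => -[->|->] [->|->] //.
    by case: pselect => //= ?; case: pselect => //= ?.
  by case: pselect => //= ?; case: pselect => //= ?.
- move=> [|[|n]] //= _.
    by exists Z1; [left|case: pselect].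
  by exists Z2; [right|case: pselect => // /esym].
Qed.
End TwoComponents.

(** * Weights in the relative interior of the cone *)

Section RelativeInterior.
Variable R : realType.

Lemma sum_e_mem (i : 'I_8) (l : triple) :
  \sum_(m : triple | i \in val m) e_ R m l = (i \in val l)%:R.
Proof.
rewrite /e_; have [il|nil] := boolP (i \in val l).
  rewrite (bigD1 l) //= eqxx big1 ?addr0 // => m /andP [_ ml].
  by rewrite eq_sym (negPf ml).
rewrite big1 // => m im; case: eqP => // lm.
by rewrite lm im in nil.
Qed.

Lemma CspP (w : triple -> R) : Csp w <-> exists (a : triple -> R) (b : 'I_8 -> R) (c : R),
  (forall m, 0 <= a m) /\ forall l,
    w l = (if val l \in nonbases_sp then a l else 0) + \sum_(i in val l) b i + c.
Proof.
have sumE (a : triple -> R) l : \sum_(m : triple | val m \in nonbases_sp) a m * e_ R m l =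
    if val l \in nonbases_sp then a l else 0.
  rewrite /e_; case: ifPn => nb.
    rewrite (bigD1 l) //= eqxx mulr1 big1 ?addr0 // => m /andP [_ ml].
    by rewrite eq_sym (negPf ml) mulr0.
  rewrite big1 // => m im; case: eqP => [lm|_]; last by rewrite mulr0.
  by rewrite lm im in nb.
have linE (b : 'I_8 -> R) l :
    \sum_i b i * (\sum_(m : triple | i \in val m) e_ R m l) = \sum_(i in val l) b i.
  rewrite [RHS]big_mkcond; apply: eq_bigr => i _; rewrite sum_e_mem.
  by case: (i \in _); rewrite ?mulr1 ?mulr0.
split=> [[a [v [b [c vE]] [a0 wE]]]|[a [b [c [a0 wE]]]]].
  by exists a, b, c; split => // l; rewrite wE sumE vE linE addrA.
exists a; exists (fun l : triple => \sum_(i in val l) b i + c).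
  by exists b, c => l; rewrite linE.
by split => // l; rewrite wE sumE addrA.
Qed.

(** At a relative interior point, all nonbasis coordinates can be lowered by a small [h] without
    leaving the cone; adding [h] back to nonnegative coefficients makes them positive. *)
Lemma relint_orbit (C : set (triple -> R)) (w : triple -> R) :
  Csp_orbit C -> relint C w -> exists (s : 'S_8) (a : triple -> R) (b : 'I_8 -> R) (c : R),
  [/\ forall l, w l = a l + \sum_(i in val l) b i + c, forall l, 0 <= a l &
      forall l, (0 < a l) = is_nonbasis s l].
Proof.
move=> [s _ <-] [Cw [eps eps0 near_w]].
pose h : R := eps / 2; have h0 : 0 < h by rewrite divr_gt0.
pose ind l : R := if is_nonbasis s l then h else 0.
have C_ind : [set perm_weight s w | w in @Csp R] (fun l => w l + ind l).
  have [w1 /CspP [a [b [c [a0 w1E]]]] w1w] := Cw.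
  exists (fun l => w1 l + if val l \in nonbases_sp then h else 0).
    apply/CspP; exists (fun l => a l + h), b, c; split => [m|l].
      by rewrite addr_ge0 // ltW.
    by rewrite w1E; case: ifP => _; ring.
  by rewrite -w1w; apply/funext.
have [w2 /CspP [a [b [c [a0 w2E]]]] w2w] :
    [set perm_weight s w | w in @Csp R] (fun l => w l - ind l).
  apply: near_w => [|l].
    (* The lowered weight is the affine combination $2w - (w + \mathrm{ind})$ of two points of the
       cone. *)
    exists 2, (fun i : 'I_2 => if i == ord0 then 2 else -1),
      (fun i : 'I_2 => if i == ord0 then w else (fun l => w l + ind l)); split.
    - by move=> i; case: ifP.
    - by rewrite !big_ord_recl big_ord0 /=; ring.
    - by move=> l; rewrite !big_ord_recl big_ord0 /=; ring.
  rewrite addrAC subrr sub0r normrN /ind; case: ifP => _; last by rewrite normr0.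
  by rewrite gtr0_norm // /h; lra.
exists s, (fun l => if is_nonbasis s l then a (perm_triple s^-1 l) + h else 0).
exists (fun i => b (s^-1%g i)), c; split => l; last first.
- by case: ifP => _; rewrite ?ltxx // ltr_wpDl.
- by case: ifP => _ //; rewrite addr_ge0 // ltW.
have <- : \sum_(i in val (perm_triple s^-1 l)) b i = \sum_(i in val l) b (s^-1%g i).
  by rewrite /= big_imset //= => i j _ _; apply: perm_inj.
have := congr1 (@^~ l) w2w; rewrite /perm_weight /= w2E -/(is_nonbasis s l) /ind.
by case: ifP => _ e; apply: (@addIr _ (- (if is_nonbasis s l then h else 0))) => //; lra.
Qed.
End RelativeInterior.

(** * The scale used for the limits *)

Section ExponentialScale.
Variable R : realType.

Let C : numClosedFieldType := R[i].

(** The power $\varepsilon_n^x$ for $\varepsilon_n = e^{-n}$. *)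
Definition tau (x : R) (n : nat) : C := (expR (- x * n%:R))%:C%C.

Lemma tauD x y n : tau (x + y) n = tau x n * tau y n.
Proof. by rewrite /tau opprD mulrDl expRD rmorphM. Qed.

Lemma tau_neq0 x n : tau x n != 0.
Proof. by rewrite /tau fmorph_eq0 gt_eqF ?expR_gt0. Qed.

Lemma tau_cvg0 x : 0 < x ->
  tau x n @[n --> \oo] --> (0 : C).
Proof.
move=> x0; apply/(@cvgrPdist_lt C C) => e e0.
have [eR re0] : e = (complex.Re e)%:C%C /\ 0 < complex.Re e.
  by move: e0; rewrite ltcE => /andP [/eqP /= i0 ->]; split => //; case: e i0 => r i /= ->.
(* For such [n], the bound $e^y \ge 1 + y$ at $y = xn$ gives $e^{xn} > 1/e$, with the last [e] the
   given tolerance. *)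
have := nbhs_infty_ger (x^-1 * (complex.Re e)^-1); apply: filterS => n nE.
rewrite sub0r normrN /tau eR normc_def /= expr0n /= addr0 sqrtr_sqr ltcR.
rewrite gtr0_norm ?expR_gt0 // mulNr expRN.
rewrite invf_plt ?posrE ?expR_gt0 //; apply: lt_le_trans (expR_ge1Dx _).
have : (complex.Re e)^-1 <= x * n%:R by rewrite -ler_pdivrMl.
by move/le_lt_trans; apply; rewrite ltrDr.
Qed.
End ExponentialScale.

Lemma cbase_morph (F k : fieldType) (iota : {rmorphism F -> k}) (s : 'S_8) (al : F) l :
  iota (cbase s al l) = cbase s (iota al) l.
Proof.
rewrite /cbase; case: ifP => _; first exact: rmorph1.
have [p [q [r [pqr ->]]]] := ltr_surj s l.
have colE n i : iota (mk_col al n i) = mk_col (iota al) n i.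
  rewrite /mk_col; do 9?[case: n => [|n]]; do 3?[case: i => [|i]];
    by rewrite /= ?nth_nil ?rmorphB ?rmorph1 ?rmorph0.
rewrite !plucker_label_mx // rmorphM rmorph_sign; congr (_ * _).
by rewrite /det3 rmorphD rmorphB !rmorphM !rmorphB !rmorphM !colE.
Qed.

(** * The two components of the initial degeneration *)

Section InitialDegeneration.
Variables (R : realType) (s : 'S_8) (w a : triple -> R).
Variables (beta : 'I_8 -> R) (gamma : R).
Hypothesis wE : forall l, w l = a l + \sum_(i in val l) beta i + gamma.
Hypothesis a_ge0 : forall l, 0 <= a l.
Hypothesis a_gt0 : forall l, (0 < a l) = is_nonbasis s l.

Let C : numClosedFieldType := R[i].

Definition mk_spec (alpha : C) (alphaE : alpha ^+ 2 - alpha + 1 = 0) :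
    Spec (grpalg charlat C) :=
  coset_spec (cexpo s) (fun l => cbase_neq0 s l alphaE).

Lemma mk_spec_initial alpha (alphaE : alpha ^+ 2 - alpha + 1 = 0) :
  initial_degeneration C w (mk_spec alphaE).
Proof.
move=> _ [n [b [g [gI ->]]]]; apply/asboolP => t t0.
rewrite raddf_sum big1 // => i _; have [f fI <-] := gI i.
rewrite /= evM; last exact: (tpoint_neq0 (cexpo s) (fun l => cbase_neq0 s l alphaE) idfun).
by rewrite (initial_form_coset (@tauD R) (@tau_neq0 R) (@tau_cvg0 R) wE a_ge0 a_gt0 alphaE) ?mulr0.
Qed.

Lemma initial_ideal_gen (f : grpalg charlat C) : IGr0 f ->
  initial_ideal w (@IGr0 C) (initial_form w f).
Proof.
move=> fI; exists 1%N, (fun=> 1), (fun=> initial_form w f); split => [_|].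
  by exists f.
by rewrite big_ord1 mul1r.
Qed.

(** The point defined by [P] has a parameter [b] in the residue field; its quadratic equation splits
    over [C], so [b] is the image of [alpha] or of [alpha']. *)
Lemma initial_degeneration_cover alpha alpha' (alphaE : alpha ^+ 2 - alpha + 1 = 0)
    (alphaE' : alpha' ^+ 2 - alpha' + 1 = 0) (sum1 : alpha + alpha' = 1) P :
  initial_degeneration C w P ->
  (forall f, mk_spec alphaE f -> P f) \/ (forall f, mk_spec alphaE' f -> P f).
Proof.
move=> PZ; have [k [rho rhoE]] := prime_is_kernel P.
pose x := point_of rho default_triple; pose iota : {rmorphism C -> k} := const_morph rho.
have x0 l : x l != 0 by apply: point_of_neq0.
have evE f : ev iota x f = rho f by apply: ev_point_of.
have xin g : IGr0 g -> ev iota x (initial_form w g) = 0.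
  by move=> gI; apply/eqP; rewrite evE -rhoE; apply: PZ; apply: initial_ideal_gen.
have rel := three_term_relation wE a_ge0 a_gt0 x0 xin.
have [b [c [t [bE c0 t0 xE]]]] := configuration_point x0 rel.
(* Up to the scalar [c], invisible to characters, [x] is then a point of the coset of [al] over
   [k]. *)
have above (al : C) (alE : al ^+ 2 - al + 1 = 0) :
    b = iota al -> forall f, mk_spec alE f -> P f.
  move=> bal f fP; have f0 := @coset_idealP _ _ _ _ k iota f fP t t0.
  rewrite rhoE -evE -f0; apply/eqP; apply: eq_bigr => u _; congr (_ * _).
  rewrite -[RHS](monom_scale _ _ c0); congr monom; apply/funext => l.
  by rewrite xE /tpoint bal cbase_morph.
(* The two roots have sum 1 and product 1, so this is the equation of [b]. *)
have : (b - iota alpha) * (b - iota alpha') = 0.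
  have sum2 : iota alpha + iota alpha' = 1 by rewrite -rmorphD sum1 rmorph1.
  have prod2 : iota alpha * iota alpha' = 1.
    rewrite -rmorphM -(rmorph1 iota); congr (iota _).
    have -> : alpha' = 1 - alpha by rewrite -sum1 addrC addKr.
    by apply: (sub_eq_of_eq0N alphaE); ring.
  transitivity (b ^+ 2 - b * (iota alpha + iota alpha') + iota alpha * iota alpha').
    by ring.
  by rewrite sum2 prod2 mulr1.
move/eqP; rewrite mulf_eq0 !subr_eq0 => /orP [/eqP e|/eqP e];
  [left|right]; exact: above e.
Qed.

Lemma mk_spec_disjoint alpha alpha' (alphaE : alpha ^+ 2 - alpha + 1 = 0)
    (alphaE' : alpha' ^+ 2 - alpha' + 1 = 0) (P : Spec (grpalg charlat C)) :
  alpha != alpha' ->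
  (forall f, mk_spec alphaE f -> P f) -> (forall f, mk_spec alphaE' f -> P f) -> False.
Proof.
move=> neq h h'.
pose sg p q r : C := (-1) ^+ sign3 (s (lab p)) (s (lab q)) (s (lab r)).
(* The four triples are bases, and the two products use the same labels, so the column scalings
   cancel. *)
pose u := quad (ltr s 1 3 6) (ltr s 2 3 4) (ltr s 2 3 6) (ltr s 1 3 4).
pose e : C := sg 1 3 6 * sg 2 3 4 / (sg 2 3 6 * sg 1 3 4).
have e0 : e != 0 by rewrite !mulf_neq0 ?invr_eq0 ?mulf_neq0 ?signr_eq0.
(* A cross-ratio takes the value [e * alpha] on the coset of [alpha]. *)
have sep (al : C) (alE : al ^+ 2 - al + 1 = 0) : mk_spec alE (mono u 1 - mono 0 (e * al)).
  apply/asboolP => t t0; rewrite raddfB /= !ev_monomial /= monom0 mul1r mulr1.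
  have x0 := tpoint_neq0 (cexpo s) (fun l => cbase_neq0 s l alE) idfun t0.
  have T p q r : sorted ltn [:: 0; p; q; r; 9]%N && ~~ nonbasis p q r ->
      tpoint (cexpo s) (cbase s al) idfun t (ltr s p q r) =
      sg p q r * det3 (mk_col al) p q r *
      (t (inl (s (lab p))) * t (inl (s (lab q))) * t (inl (s (lab r)))).
    move=> /andP [pqr nb]; rewrite /tpoint prod_cexpo /cbase is_nonbasis_ltr // (negPf nb).
    by rewrite prod_ltr //= plucker_label_mx.
  rewrite monom_quad // !T //.
  have tn i : t (inl i) != 0 by apply: t0.
  apply/eqP; rewrite subr_eq0; apply/eqP; rewrite /e /det3 /mk_col /=.
  field.
  by rewrite !tn !signr_eq0.
(* The two values of the cross-ratio differ by a nonzero constant, which would be a unit in [P]. *)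
have Pone : P (mono 0 (e * (alpha - alpha'))).
  have [_ _ PD] := prime_ideal P.
  have := PD (-1) _ _ (h _ (sep _ alphaE)) (h' _ (sep _ alphaE')).
  by rewrite mulN1r opprB addrA subrK /mono -monalgUB -mulrBr.
have [_ P1 PD] := prime_ideal P.
move/negP: P1; apply; have [P0 _ _] := prime_ideal P.
have := PD (mono 0 (e * (alpha - alpha'))^-1) _ _ Pone P0.
by rewrite addr0 monoM addr0 mulVf // mulf_neq0 // subr_eq0.
Qed.

Lemma initial_degeneration_components :
  (components (initial_degeneration C w) #= `I_2)%card.
Proof.
pose alpha : C := (1 + sqrtC (-3)) / 2; pose alpha' : C := (1 - sqrtC (-3)) / 2.
have r3 : sqrtC (-3 : C) ^+ 2 = -3 by rewrite sqrtCK.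
have alphaE : alpha ^+ 2 - alpha + 1 = 0.
  transitivity ((sqrtC (-3) ^+ 2 + 3) / 4 : C); first by rewrite /alpha; field.
  by rewrite r3 addNr mul0r.
have alphaE' : alpha' ^+ 2 - alpha' + 1 = 0.
  transitivity ((sqrtC (-3) ^+ 2 + 3) / 4 : C); first by rewrite /alpha'; field.
  by rewrite r3 addNr mul0r.
have sum1 : alpha + alpha' = 1 by rewrite /alpha /alpha'; field.
have neq : alpha != alpha'.
  rewrite -subr_eq0 (_ : alpha - alpha' = sqrtC (-3)); last by rewrite /alpha /alpha'; field.
  by rewrite sqrtC_eq0 oppr_eq0 pnatr_eq0.
apply: (@two_components _ _ (mk_spec alphaE) (mk_spec alphaE')).
- exact: mk_spec_initial.
- exact: mk_spec_initial.
- by move=> P; apply: initial_degeneration_cover.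
- by move=> P; apply: mk_spec_disjoint.
Qed.
End InitialDegeneration.

Theorem theorem1p3 (R : realType) (C : set (triple -> R)) (w : triple -> R)
    (HC : Csp_orbit C) (Hw : relint C w) :
  (components (initial_degeneration R[i] w) #= `I_2)%card.
Proof.
have [s [a [b [c [wE a_ge0 a_gt0]]]]] := relint_orbit HC Hw.
exact: initial_degeneration_components wE a_ge0 a_gt0.
Qed.
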